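(* The sequence $\{V_m\}_{m\ge 1}$ converges to $V$ uniformly on $[0,T]\times D$. More precisely, for all $(s,\vec\pi)\in[0,T]\times D$ and all $m\in\mathbb N$, $$V_m(s,\vec\pi)\le V(s,\vec\pi)\le V_m(s,\vec\pi)+\bigl(T\|C\|+2\|H\|\bigr)\left(\frac{\bar\lambda\,T}{m-1}\right)^{1/2}\left(\frac{\bar\lambda}{2\rho+\bar\lambda}\right)^{m/2},$$ where $\|C\|=\max_{\vec\pi\in D}|C(\vec\pi)|$, $\|H\|=\max_{\vec\pi\in D}|H(\vec\pi)|$, $\bar\lambda=\max_{i\in E}\lambda_i$ (for $m=1$ the upper bound is read as $+\infty$).
   Context: Fix $n,a,p\in\mathbb N=\{1,2,\dots\}$, $E=\{1,\dots,n\}$, $\mathcal A=\{1,\dots,a\}$, a horizon $0<T<\infty$, a discount rate $\rho\ge 0$, and real numbers $c_i$, $\mu_{k,i}$ ($i\in E$, $k\in\mathcal A$). $M=\{M_t\}_{t\ge0}$ is a continuous-time Markov chain on $E$ with infinitesimal generator $Q=(q_{ij})$. $X^{(1)},\dots,X^{(n)}$ are independent $\mathbb R^p$-valued compound Poisson processes, independent of $M$; $X^{(i)}$ has arrival rate $\lambda_i>0$ and jump distribution $\nu_i$ (a probability measure on $\mathbb R^p$ with $\nu_i(\{0\})=0$). The observation process is $X_t=X_0+\int_{(0,t]}\sum_{i\in E}1_{\{M_s=i\}}\,dX^{(i)}_s$ with $X_0$ deterministic, and $\mathbb F=\{\mathcal F^X_t\}_{t\ge0}$ is the filtration generated by $X$.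 Put $\sigma_0=0$, $\sigma_m=\inf\{t>\sigma_{m-1}:X_t\ne X_{t-}\}$, $Y_m=X_{\sigma_m}-X_{\sigma_m-}$ for $m\ge1$. Let $\nu=\nu_1+\dots+\nu_n$ and $f_i=d\nu_i/d\nu$. $D=\{\vec\pi\in\mathbb R_+^n:\pi_1+\dots+\pi_n=1\}$; for $\vec\pi\in D$, $\mathbb P^{\vec\pi}$ (expectation $\mathbb E^{\vec\pi}$) is the probability under which $M$ has initial distribution $\vec\pi$. The conditional probability process is $\vec\Pi_t=(\Pi^{(1)}_t,\dots,\Pi^{(n)}_t)$, $\Pi^{(i)}_t=\mathbb P^{\vec\pi}\{M_t=i\mid\mathcal F^X_t\}$, taken in its càdlàg version: with $I(t)=\int_0^t\sum_i\lambda_i1_{\{M_s=i\}}ds$ and $x_i(t,\vec\pi)=\mathbb E^{\vec\pi}[1_{\{M_t=i\}}e^{-I(t)}]/\mathbb E^{\vec\pi}[e^{-I(t)}]$, $\vec x=(x_1,\dots,x_n)$, one has $\vec\Pi_0=\vec\pi$, $\vec\Pi_t=\vec x(t-\sigma_m,\vec\Pi_{\sigma_m})$ for $\sigma_m\le t<\sigma_{m+1}$, and $\Pi^{(i)}_{\sigma_m}=\lambda_if_i(Y_m)\Pi^{(i)}_{\sigma_m-}/\sum_{j}\lambda_jf_j(Y_m)\Pi^{(j)}_{\sigma_m-}$ for $m\ge 1$. Let $C(\vec\pi)=\sum_{i\in E}c_i\pi_i$, $H_k(\vec\pi)=\sum_{i\in E}\mu_{k,i}\pi_i$, $H(\vec\pi)=\max_{k\in\mathcal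 A}H_k(\vec\pi)$. For $(s,\vec\pi)\in[0,T]\times D$ and $m\in\mathbb N$, with suprema over $\mathbb F$-stopping times $\tau\le s$, $$V(s,\vec\pi)=\sup_{\tau\le s}\mathbb E^{\vec\pi}\Bigl[\int_0^\tau e^{-\rho t}C(\vec\Pi_t)dt+e^{-\rho\tau}H(\vec\Pi_\tau)\Bigr],\quad V_m(s,\vec\pi)=\sup_{\tau\le s}\mathbb E^{\vec\pi}\Bigl[\int_0^{\tau\wedge\sigma_m}e^{-\rho t}C(\vec\Pi_t)dt+e^{-\rho(\tau\wedge\sigma_m)}H(\vec\Pi_{\tau\wedge\sigma_m})\Bigr].$$ *)

(* Defs.v *)
From HB Require Import structures.
From mathcomp Require Import all_boot all_order all_algebra finmap.
From mathcomp Require Import all_classical all_reals all_analysis.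

Set Implicit Arguments.
Unset Strict Implicit.
Unset Printing Implicit Defensive.

Import Order.TTheory GRing.Theory Num.Theory.
Import numFieldNormedType.Exports.

Local Open Scope classical_set_scope.
Local Open Scope ring_scope.

(* R^p with its Borel sigma-algebra *)
Definition borelRV (R : realType) (p : nat) :=
  g_sigma_algebraType (@open 'rV[R]_p).

(* Processes are functions [R -> Omega -> S] of which only the times t >= 0
   are ever constrained or used. *)

Section generalities.
Context {R : realType}.

Definition left_limit {T : ptopologicalType} (g : R -> T) (t : R) : T :=
  lim (g u @[u --> t^'-]).

(* sigma-algebra generated by Z_u, u in J; G is the sigma-algebra of S *)
Definition sigma_of {Omega S : Type} (G : set_system S) (J : set R)
    (Z : R -> Omega -> S) : set_system Omega :=
  <<s [set A | exists u B, [/\ J u, G B & A = Z u @^-1` B]] >>.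

Definition natural_filtration {Omega S : Type} (G : set_system S)
    (Z : R -> Omega -> S) (t : R) : set_system Omega :=
  sigma_of G `[0, t] Z.

Definition sigma_of_process {Omega S : Type} (G : set_system S)
    (Z : R -> Omega -> S) : set_system Omega :=
  sigma_of G `[0, +oo[ Z.

Definition euclidean_sets (p : nat) : set_system 'rV[R]_p :=
  @measurable _ (borelRV R p).

Definition mutually_independent {d} {Omega : measurableType d}
    (P : probability Omega R) {I : choiceType} (F : I -> set_system Omega) :=
  forall (J : {fset I}) (A : I -> set Omega),
    (forall i, i \in J -> F i (A i)) ->
    P (\bigcap_(i in [set` J]) A i) = (\prod_(i <- J) P (A i))%E.

Definition simplex (n : nat) : set 'rV[R]_n :=
  [set v | (forall i, 0 <= v ord0 i) /\ \sum_i v ord0 i = 1].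

End generalities.

Arguments euclidean_sets {R} p _.
Arguments simplex {R} n _.

Section processes.
Context {R : realType} {d : measure_display} {Omega : measurableType d}.

Definition poisson_process (P : probability Omega R) (lambda : R)
    (N : R -> Omega -> nat) : Prop :=
  [/\ (forall t k, 0 <= t -> measurable (N t @^-1` [set k])),
      (forall w, [/\ N 0 w = 0%N,
         (forall s t, 0 <= s -> s <= t -> (N s w <= N t w)%N) &
         (forall t, 0 <= t -> \forall u \near t^'+, N u w = N t w)]) &
      (* s < t: poisson_pmf is not the Dirac mass at 0 for a zero rate *)
      (forall s t k A, 0 <= s -> s < t ->
         natural_filtration setT N s A ->
         P (A `&` [set w | (N t w - N s w)%N = k]) =
         (P A * (poisson_pmf (lambda * (t - s)) k)%:E)%E)].

Definition compound_poisson {p : nat} (P : probability Omega R) (lambda : R)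
    (nu : probability (borelRV R p) R) (Z : R -> Omega -> 'rV[R]_p) : Prop :=
  exists (N : R -> Omega -> nat) (Y : nat -> Omega -> 'rV[R]_p),
  [/\ poisson_process P lambda N,
      (forall k B, euclidean_sets p B ->
         measurable (Y k @^-1` B) /\ P (Y k @^-1` B) = nu B),
      mutually_independent P (fun o : option nat =>
        if o is Some k then [set Y k @^-1` B | B in euclidean_sets p]
        else sigma_of_process setT N) &
      (forall t w, 0 <= t -> Z t w = \sum_(k < N t w) Y k w)].

Definition transition_semigroup {n : nat} (Pt : R -> 'M[R]_n) : Prop :=
  [/\ (forall t, 0 <= t ->
         forall i, (forall j, 0 <= Pt t i j) /\ \sum_j Pt t i j = 1),
      Pt 0 = 1%:M &
      (forall s t, 0 <= s -> 0 <= t -> Pt (s + t) = Pt s *m Pt t)].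

Definition has_generator {n : nat} (Pt : R -> 'M[R]_n) (Q : 'M[R]_n) : Prop :=
  h^-1 *: (Pt h - 1%:M) @[h --> 0^'+] --> Q.

(* right-continuous Markov chain with left limits (i.e. piecewise constant
   paths), initial distribution pi and generator Q *)
Definition markov_chain {n : nat} (P : probability Omega R) (Q : 'M[R]_n)
    (pi : 'rV[R]_n) (M : R -> Omega -> 'I_n) : Prop :=
  [/\ (forall t i, 0 <= t -> measurable (M t @^-1` [set i])),
      (forall w,
         (forall t, 0 <= t -> \forall u \near t^'+, M u w = M t w) /\
         (forall t, 0 < t -> exists i, \forall u \near t^'-, M u w = i)),
      (forall i, P (M 0 @^-1` [set i]) = (pi ord0 i)%:E) &
      exists Pt : R -> 'M[R]_n,
        [/\ transition_semigroup Pt, has_generator Pt Q &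
         (* P(M_t = j | sigma(M_u, u <= s)) = (Pt (t - s)) M_s j, integrated
            over A and {M_s = i} *)
         forall s t i j A, 0 <= s -> s <= t ->
           natural_filtration setT M s A ->
           P (A `&` M s @^-1` [set i] `&` M t @^-1` [set j]) =
           (P (A `&` M s @^-1` [set i]) * (Pt (t - s) i j)%:E)%E]].

Definition hidden_markov_model {n p : nat} (P : probability Omega R)
    (Q : 'M[R]_n) (lambda : 'I_n -> R)
    (nu : 'I_n -> probability (borelRV R p) R) (pi : 'rV[R]_n)
    (M : R -> Omega -> 'I_n) (Xi : 'I_n -> R -> Omega -> 'rV[R]_p) : Prop :=
  [/\ markov_chain P Q pi M,
      (forall i, compound_poisson P (lambda i) (nu i) (Xi i)) &
      mutually_independent P (fun o : option 'I_n =>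
        if o is Some i then sigma_of_process (euclidean_sets p) (Xi i)
        else sigma_of_process setT M)].

(* X_t = X_0 + int_(0,t] sum_i 1_{M_s = i} dX^(i)_s.  The X^(i) are pure-jump
   step functions, so the pathwise Stieltjes integral is the (finitely
   supported) sum over the jump times in ]0, t]. *)
Definition observation {n p : nat} (x0 : 'rV[R]_p) (M : R -> Omega -> 'I_n)
    (Xi : 'I_n -> R -> Omega -> 'rV[R]_p) (t : R) (w : Omega) : 'rV[R]_p :=
  x0 + \sum_(s \in `]0, t])
         \sum_i (M s w == i)%:R *: (Xi i s w - left_limit (Xi i ^~ w) s).

(* sigma_m, equal to +oo when there are fewer than m jumps *)
Fixpoint jump_time {p : nat} (X : R -> Omega -> 'rV[R]_p) (m : nat)
    (w : Omega) : \bar R :=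
  if m is m'.+1 then
    ereal_inf [set t%:E | t in
      [set t | (jump_time X m' w < t%:E)%E /\ X t w != left_limit (X ^~ w) t]]
  else 0%E.

Definition observation_filtration {p : nat} (X : R -> Omega -> 'rV[R]_p) :=
  natural_filtration (euclidean_sets p) X.

Definition jump_density {n p : nat} (nu : 'I_n -> probability (borelRV R p) R)
    (nusum : {measure set (borelRV R p) -> \bar R})
    (f : 'I_n -> borelRV R p -> R) : Prop :=
  forall i, [/\ measurable_fun setT (f i), (forall y, 0 <= f i y) &
    forall B, measurable B -> nu i B = (\int[nusum]_(y in B) (f i y)%:E)%E].

Definition cumulative_rate {n : nat} (lambda : 'I_n -> R)
    (M : R -> Omega -> 'I_n) (t : R) (w : Omega) : R :=
  \int[lebesgue_measure]_(s in `[0, t])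
    (\sum_i lambda i * (M s w == i)%:R).

(* Pr pi is the probability measure under which M has initial law pi. *)
Definition flow {n : nat} (Pr : 'rV[R]_n -> probability Omega R)
    (lambda : 'I_n -> R) (M : R -> Omega -> 'I_n) (t : R) (pi : 'rV[R]_n) :
    'rV[R]_n :=
  \row_i
    (fine 'E_(Pr pi)[(fun w =>
            (M t w == i)%:R * expR (- cumulative_rate lambda M t w))%R]%E /
     fine 'E_(Pr pi)[(fun w => expR (- cumulative_rate lambda M t w))%R]%E).

(* Pi^(i)_t is a version of P(M_t = i | F_t) for the filtration F *)
Definition conditional_probability {n : nat} (P : probability Omega R)
    (F : R -> set_system Omega) (M : R -> Omega -> 'I_n)
    (Pi : R -> Omega -> 'rV[R]_n) : Prop :=
  forall t i, 0 <= t ->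
    (forall B : set R, measurable B ->
       F t ((fun w => Pi t w ord0 i) @^-1` B)) /\
    (forall A, F t A ->
       (\int[P]_(w in A) (Pi t w ord0 i)%:E)%E =
       P (A `&` M t @^-1` [set i])).

(* The Bayes update is required where its denominator is nonzero, which is the
   case almost surely.  Elsewhere Pi_(sigma_m) is left unspecified: since
   inverses are total, the bare formula would give the zero vector and
   contradict the second clause at t = sigma_m. *)
Definition filter_dynamics {n p : nat}
    (x : R -> 'rV[R]_n -> 'rV[R]_n) (lambda : 'I_n -> R)
    (f : 'I_n -> borelRV R p -> R) (X : R -> Omega -> 'rV[R]_p)
    (pi : 'rV[R]_n) (Pi : R -> Omega -> 'rV[R]_n) : Prop :=
  forall w,
  [/\ Pi 0 w = pi,
      (forall m t, (jump_time X m w <= t%:E < jump_time X m.+1 w)%E ->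
         let sm := fine (jump_time X m w) in
         Pi t w = x (t - sm) (Pi sm w)) &
      (forall m, (jump_time X m.+1 w < +oo)%E ->
         let sm := fine (jump_time X m.+1 w) in
         let y := X sm w - left_limit (X ^~ w) sm in
         let Pi_left := left_limit (Pi ^~ w) sm in
         let Z := \sum_j lambda j * f j y * Pi_left ord0 j in
         Z != 0 ->
         forall i, Pi sm w ord0 i = lambda i * f i y * Pi_left ord0 i / Z)].

(* F-stopping times with values in [0, s] *)
Definition stopping_times (F : R -> set_system Omega) (s : R) :
    set (Omega -> R) :=
  [set tau | (forall w, 0 <= tau w <= s) /\
             forall t, 0 <= t -> F t [set w | tau w <= t]].

Definition payoff {n : nat} (rho : R) (C H : 'rV[R]_n -> R)
    (Pi : R -> Omega -> 'rV[R]_n) (theta : Omega -> R) (w : Omega) : R :=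
  \int[lebesgue_measure]_(t in `[0, theta w]) (expR (- rho * t) * C (Pi t w))
  + expR (- rho * theta w) * H (Pi (theta w) w).

Definition value {n p : nat} (rho : R) (C H : 'rV[R]_n -> R)
    (P : probability Omega R) (X : R -> Omega -> 'rV[R]_p)
    (Pi : R -> Omega -> 'rV[R]_n) (s : R) : \bar R :=
  ereal_sup [set ('E_P[payoff rho C H Pi tau])%E |
             tau in stopping_times (observation_filtration X) s].

Definition value_jumps {n p : nat} (rho : R) (C H : 'rV[R]_n -> R)
    (P : probability Omega R) (X : R -> Omega -> 'rV[R]_p)
    (Pi : R -> Omega -> 'rV[R]_n) (m : nat) (s : R) : \bar R :=
  ereal_sup [set ('E_P[payoff rho C H Pi
                         (fun w => fine (mine (tau w)%:E (jump_time X m w)))])%E |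
             tau in stopping_times (observation_filtration X) s].

End processes.

Section rewards.
Context {R : realType}.

Definition linear_reward {n : nat} (c : 'I_n -> R) (pi : 'rV[R]_n) : R :=
  \sum_i c i * pi ord0 i.

(* The suprema below are over a finite set, resp. of a continuous function
   over the compact simplex: they are maxima as soon as a, n > 0. *)
Definition terminal_reward {n a : nat} (mu : 'I_a -> 'I_n -> R)
    (pi : 'rV[R]_n) : R :=
  sup [set linear_reward (mu k) pi | k in [set: 'I_a]].

Definition simplex_norm {n : nat} (g : 'rV[R]_n -> R) : R :=
  sup [set `|g pi| | pi in simplex n].

Definition max_rate {n : nat} (lambda : 'I_n -> R) : R :=
  sup [set lambda i | i in [set: 'I_n]].

Definition error_bound (T rho normC normH lbar : R) (m : nat) : \bar R :=
  if m == 1%N then +oo%E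
  else ((T * normC + 2 * normH) * (lbar * T / (m%:R - 1)) `^ 2^-1
        * (lbar / (2 * rho + lbar)) `^ (m%:R / 2))%:E.

End rewards.

(* Main.v *)
Require Import Defs.
From HB Require Import structures.
From mathcomp Require Import all_boot all_order all_algebra finmap.
From mathcomp Require Import all_classical all_reals all_analysis.
From mathcomp Require Import measurable_realfun.
From mathcomp Require Import ring lra.

Set Implicit Arguments.
Unset Strict Implicit.
Unset Printing Implicit Defensive.

Import Order.TTheory GRing.Theory Num.Theory.
Import numFieldNormedType.Exports.

Local Open Scope classical_set_scope.
Local Open Scope ring_scope.

(** Stopping at the m-th observed jump is one way of stopping, since the jump
times of X are stopping times of its filtration; this gives the lower bound.
For the upper bound, a stopping time tau <= s <= T and its capped version
min (tau, sigma_m) give the same payoff unless sigma_m < tau, and then the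
payoffs differ by at most (T |C| + 2 |H|) exp (- rho sigma_m), because the
filter stays in the simplex.  So the error is at most

  (T |C| + 2 |H|) E[1_{sigma_m <= T} exp (- rho sigma_m)].

Whatever the hidden state, jumps are observed at a rate which is at most
lbar = max_i lambda_i.  Hence sigma_m is stochastically larger than a sum of m
independent exponential variables of rate lbar, and for all z >= 0

  E[1_{sigma_m <= T} exp (- z sigma_m)] <= (lbar / (lbar + z)) ^ m

(expectation_discount_at_jump).  Taking z = rho + q and using
exp (- rho sigma_m) <= exp (q T) exp (- (rho + q) sigma_m) on sigma_m <= T, the
rate of the statement comes from the choice of q made in exponential_tilt.

The Laplace transform bound is proved on grids.  On a cell without simultaneous
jumps the observed increment is that of the source selected by the state at the
right end point (observation_increment).  Conditioning on the states at the
grid points, which are independent of the sources, and using that a source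
changes on a cell with probability at most 1 - exp (- lbar h) whatever it did
before (compound_sum_change), each cell shows a change with at most that
probability given the earlier cells (state_change_prefix).  A discrete
supermartingale then bounds the discounted waiting time for the m-th change
(integral_discounted_hit), and the mesh h tends to 0.

The expectations make sense because the filter is right-continuous in time, so
that payoffs are measurable: between jumps it follows the flow, a quotient of
integrals of right-continuous functions of time (flow_law_right_continuous). *)

(** * Step paths *)

Section step_paths.
Context {R : realType}.

(** The compactness of [0, t] in inductive form, used to find a mesh below
which the cells of a path have at most one jump. *)
Lemma real_induction (Q : R -> Prop) :
  Q 0 ->
  (forall v, 0 <= v -> Q v -> \forall u \near v^'+, Q u) ->
  (forall v, 0 < v -> (forall u, 0 <= u -> u < v -> Q u) -> Q v) ->
  forall t, 0 <= t -> Q t.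
Proof.
move=> Q0 Qr Ql t t0.
pose S := [set v | 0 <= v <= t /\ forall u, 0 <= u -> u <= v -> Q u].
have S0 : S 0.
  by split=> [|u u0 u1]; [rewrite lexx|rewrite (_ : u = 0)//; apply/eqP; rewrite eq_le u0 u1].
have hS : has_sup S by split; [exists 0|exists t => v [/andP[]]].
set m := sup S.
have m0 : 0 <= m by apply: ub_le_sup => //; case: hS.
have mt : m <= t by apply: ge_sup; [exists 0|move=> v [/andP[]]].
have Qlt u : 0 <= u -> u < m -> Q u.
  move=> u0 um; have [v [_ Sv] uv] := sup_gt (ex_intro _ _ S0) um.
  by apply: Sv => //; exact: ltW.
have Qm : Q m.
  move: m0; rewrite le_eqVlt => /predU1P[<-//|m0]; apply: Ql => //.
have Qle u : 0 <= u -> u <= m -> Q u.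
  by move=> u0; rewrite le_eqVlt => /predU1P[->//|]; exact: Qlt.
move: mt; rewrite le_eqVlt => /predU1P[<-//|mt].
exfalso.
have : \forall u \near m^'+, Q u by exact: Qr.
case=> e /= e0 He.
pose v := Num.min t (m + e / 2).
have mv : m < v by rewrite lt_min mt ltrDl divr_gt0.
suff : S v by move=> Sv; have := ub_le_sup hS.2 Sv; rewrite leNgt mv.
split; first by rewrite (le_trans m0 (ltW mv)) ge_min lexx.
move=> u u0 uv; have [um|mu] := leP u m; first exact: Qle.
apply: He => //=; rewrite ltr0_norm ?subr_lt0// opprB ltrBlDl.
have : u <= m + e / 2 by rewrite (le_trans uv)// ge_min lexx orbT.
move=> /le_lt_trans; apply; rewrite ltrD2l; lra.
Qed.


Lemma near_rightP (Q : R -> Prop) t :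
  (\forall u \near t^'+, Q u) <->
  (exists2 e, 0 < e & forall u, t < u < t + e -> Q u).
Proof.
split=> [[e /= e0 He]|[e e0 He]].
  exists e => // u /andP[tu ue]; apply: He => //=.
  by rewrite ltr0_norm ?subr_lt0// opprB ltrBlDl.
exists e => //= u /= + tu; rewrite ltr0_norm ?subr_lt0// opprB ltrBlDl => ue.
by apply: He; rewrite tu ue.
Qed.

Lemma near_leftP (Q : R -> Prop) t :
  (\forall u \near t^'-, Q u) <->
  (exists2 e, 0 < e & forall u, t - e < u < t -> Q u).
Proof.
split=> [[e /= e0 He]|[e e0 He]].
  exists e => // u /andP[tu ue]; apply: He => //=.
  by rewrite gtr0_norm ?subr_gt0// ltrBlDr -ltrBlDl.
exists e => //= u /= + tu; rewrite gtr0_norm ?subr_gt0// ltrBlDr -ltrBlDl => ue.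
by apply: He; rewrite ue tu.
Qed.

(** No topology is put on S, so that the notion applies to tuples of paths. *)
Definition step_path {S : Type} (P : R -> S) :=
  (forall t, 0 <= t -> \forall u \near t^'+, P u = P t) /\
  (forall t, 0 < t -> exists c, \forall u \near t^'-, P u = c).

(** A path which is constant on [a, b] is included, with c = b. *)
Definition one_jump_cell {S : Type} (P : R -> S) (a b : R) :=
  exists c, [/\ a < c <= b, (forall u, a <= u < c -> P u = P a) &
                (forall u, c <= u <= b -> P u = P b)].

(** A Lebesgue number for the cover of [0, t] by neighbourhoods in which the
path jumps at most once. *)
Lemma step_path_mesh {S : Type} (P : R -> S) t : step_path P -> 0 <= t ->
  exists2 delta, 0 < delta & forall a b, 0 <= a -> a < b -> b <= t ->
    b - a < delta -> one_jump_cell P a b.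
Proof.
move=> [Pr Pl]; move: t; apply: real_induction.
- exists 1 => // a b a0 ab b0; suff: a < a by rewrite ltxx.
  by rewrite (lt_le_trans ab)// (le_trans b0).
- move=> v v0 [d d0 Hd].
  have /near_rightP[e e0 He] := Pr _ v0.
  have [c [e' e'0 He']] : exists c, exists2 e', 0 < e' &
      forall u, 0 <= u -> v - e' < u < v -> P u = c.
    move: v0; rewrite le_eqVlt => /predU1P[v0|v0].
      exists (P 0), 1 => // u u0 /andP[_]; rewrite -v0 => u1.
      by move: (le_lt_trans u0 u1); rewrite ltxx.
    have [c /near_leftP[e' e'0 He']] := Pl _ v0.
    by exists c, e' => // u _; exact: He'.
  (* P is constant on [v, v + e) and on (v - e', v), so a short cell that
     straddles v has its only jump at v. *)
  apply/near_rightP; exists e => // u /andP[vu uve].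
  exists (Num.min d e'); first by rewrite lt_min d0.
  move=> a b a0 ab bu; rewrite lt_min => /andP[bad bae].
  have [bv|vb] := leP b v; first exact: Hd.
  have HPv w : v <= w <= b -> P w = P v.
    move=> /andP[]; rewrite le_eqVlt => /predU1P[->//|vw wb].
    by apply: He; rewrite vw/= (le_lt_trans wb)// (le_lt_trans bu).
  have [va|av] := leP v a.
    exists b; split; [by rewrite ab lexx| |].
      move=> w /andP[aw wb]; rewrite !HPv//; first by rewrite va ltW.
      by rewrite (le_trans va aw) ltW.
    by move=> w /andP[bw wb]; congr P; apply/eqP; rewrite eq_le bw wb.
  exists v; split; first by rewrite av ltW.
    move=> w /andP[aw wv]; rewrite !He'//.
    + by rewrite av andbT; lra.
    + exact: le_trans aw.
    + by rewrite wv andbT; lra.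
  by move=> w vwb; rewrite !HPv// ltW//= lexx.
  (* The mesh is taken so small that a cell reaching beyond u lies in
     (v - e, v], where P can only jump at v. *)
- move=> v v0 IH.
  have [c /near_leftP[e e0 He]] := Pl _ v0.
  pose u := Num.max 0 (v - e / 2).
  have uv : u < v by rewrite gt_max v0/= ltrBlDr ltrDl divr_gt0.
  have u0 : 0 <= u by rewrite le_max lexx.
  have veu : v - e < u by rewrite lt_max; apply/orP; right; lra.
  have [d d0 Hd] := IH u u0 uv.
  exists (Num.min d (u - (v - e))); first by rewrite lt_min d0 subr_gt0.
  move=> a b a0 ab bv; rewrite lt_min => /andP[bad bae].
  have [bu|ub] := leP b u; first exact: Hd.
  have aev : v - e < a by lra.
  exists b; split; [by rewrite ab lexx| |].
    move=> w /andP[aw wb]; rewrite !He//.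
      by rewrite aev (lt_le_trans ab).
    by rewrite (lt_le_trans aev aw) (lt_le_trans wb).
  by move=> w /andP[bw wb]; congr P; apply/eqP; rewrite eq_le bw wb.
Qed.

End step_paths.

Section counting_paths.
Context {R : realType}.

(** The left limit at t is the largest of the values taken before t, which are
bounded by N t. *)
Lemma step_path_counting (N : R -> nat) :
  (forall s t, 0 <= s -> s <= t -> (N s <= N t)%N) ->
  (forall t, 0 <= t -> \forall u \near t^'+, N u = N t) -> step_path N.
Proof.
move=> Nnd Nr; split=> // t t0.
pose vals := fun k => `[< exists u, [/\ 0 <= u, u < t & N u = k] >].
have vals0 : exists k, vals k by exists (N 0); apply/asboolP; exists 0.
have valsb k : vals k -> (k <= N t)%N.
  by move=> /asboolP[u [u0 ut <-]]; apply: Nnd => //; exact: ltW.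
case: (ex_maxnP vals0 valsb) => k /asboolP[v [v0 vt Nv]] kmax.
exists k; apply/near_leftP; exists (t - v); first by rewrite subr_gt0.
move=> u /andP[]; rewrite opprB addrCA subrr addr0 => vu ut.
apply/eqP; rewrite eqn_leq kmax/=; first by rewrite -Nv Nnd// ltW.
by apply/asboolP; exists u; split=> //; rewrite (le_trans v0)// ltW.
Qed.

Lemma step_path_image {S S' : Type} (P : R -> S) (F : S -> S') (Z : R -> S') :
  (forall t, 0 <= t -> Z t = F (P t)) -> step_path P -> step_path Z.
Proof.
move=> ZE [Pr Pl]; split.
  move=> t t0; have /near_rightP[e e0 He] := Pr _ t0.
  apply/near_rightP; exists e => // u ute; rewrite !ZE ?He//.
  by case/andP: ute => tu _; rewrite (le_trans t0)// ltW.
move=> t t0; have [c /near_leftP[e e0 He]] := Pl _ t0.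
exists (F c); apply/near_leftP; exists (Num.min e t).
  by rewrite lt_min e0 t0.
move=> u /andP[tu ut].
have [tu1 tu2] : t - e < u /\ 0 < u.
  have : Num.min e t <= e by rewrite ge_min lexx.
  have : Num.min e t <= t by rewrite ge_min lexx orbT.
  by move=> ? ?; split; lra.
by rewrite ZE ?(ltW tu2)// He// tu1.
Qed.

Lemma step_path_family {n : nat} {S : Type} (Z : 'I_n -> R -> S) :
  (forall i, step_path (Z i)) -> step_path (fun t i => Z i t).
Proof.
move=> Zs; split=> t t0.
  have : \forall u \near t^'+, forall i, Z i u = Z i t.
    by apply: filter_forall => i; exact: (Zs i).1.
  by apply: filterS => u Hu; apply/funext.
have /choice[c Hc] : forall i, exists c, \forall u \near t^'-, Z i u = c.
  by move=> i; exact: (Zs i).2.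
exists c.
have : \forall u \near t^'-, forall i, Z i u = c i.
  by apply: filter_forall => i; exact: Hc.
by apply: filterS => u Hu; apply/funext.
Qed.

Lemma step_path_pair {S S' : Type} (P : R -> S) (P' : R -> S') :
  step_path P -> step_path P' -> step_path (fun t => (P t, P' t)).
Proof.
move=> [Pr Pl] [P'r P'l]; split=> t t0.
  by near=> u; congr (_, _); near: u; [exact: Pr|exact: P'r].
have [c Hc] := Pl _ t0; have [c' Hc'] := P'l _ t0.
by exists (c, c'); near=> u; congr (_, _); near: u.
Unshelve. all: by end_near. Qed.

End counting_paths.

(** * Equidistant grids *)

Section grids.
Context {R : realType}.

Lemma grid_mesh_lt (t d : R) : 0 < d -> \forall n \near \oo, t / n.+1%:R < d.
Proof.
move=> d0; near=> n.
rewrite ltr_pdivrMr// mulrC -ltr_pdivrMr//.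
have : t / d < n%:R by near: n; exact: nbhs_infty_gtr.
by move=> /lt_trans; apply; rewrite ltr_nat.
Unshelve. all: by end_near. Qed.

Definition grid (t : R) (n l : nat) : R := l%:R * (t / n.+1%:R).

Lemma grid0 t n : grid t n 0 = 0. Proof. by rewrite /grid mul0r. Qed.

Lemma grid_last t n : grid t n n.+1 = t.
Proof. by rewrite /grid mulrCA divff ?mulr1. Qed.

Lemma grid_step t n l : grid t n l.+1 - grid t n l = t / n.+1%:R.
Proof. by rewrite /grid -mulrBl -natrB// subSnn mul1r. Qed.

Lemma grid_ge0 t n l : 0 <= t -> 0 <= grid t n l.
Proof. by move=> t0; rewrite mulr_ge0// divr_ge0. Qed.

Lemma grid_mono t n l k : 0 <= t -> (l <= k)%N -> grid t n l <= grid t n k.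
Proof. by move=> t0 lk; rewrite ler_wpM2r ?divr_ge0// ler_nat. Qed.

Lemma grid_lt_succ t n l : 0 < t -> grid t n l < grid t n l.+1.
Proof. by move=> t0; rewrite -subr_gt0 grid_step divr_gt0. Qed.

Lemma grid_le t n l : 0 <= t -> (l <= n.+1)%N -> grid t n l <= t.
Proof. by move=> t0 ln; rewrite -[leRHS](grid_last t n) grid_mono. Qed.

Lemma step_path_grid {S : Type} (P : R -> S) t : step_path P -> 0 < t ->
  \forall n \near \oo, forall l, (l < n.+1)%N ->
    one_jump_cell P (grid t n l) (grid t n l.+1).
Proof.
move=> sP t0; have [e e0 He] := step_path_mesh sP (ltW t0).
near=> n => l ln; apply: He.
- exact/grid_ge0/ltW.
- exact: grid_lt_succ.
- by apply: grid_le => //; exact: ltW.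
- by rewrite grid_step; near: n; exact: grid_mesh_lt.
Unshelve. all: by end_near. Qed.

End grids.

(** * Paths of the observation process *)

Section sums_over_jumps.
Context {R : realType}.

Lemma left_limit_cst {p : nat} (g : R -> 'rV[R]_p) (t : R) c :
  (\forall u \near t^'-, g u = c) -> left_limit g t = c.
Proof.
move=> gc; apply: cvg_lim; first exact: norm_hausdorff.
by apply: cvg_near_cst.
Qed.

(** The sum over all times in ]0, b] of a function with finite support, which
is how the observation integrates the hidden state against the sources, grows
on a cell by the value at the single jump of the cell. *)
Lemma fsbig_oc_extend {V : zmodType} (F : R -> V) (a b c : R) :
  0 <= a -> a < c -> c <= b ->
  (forall s, a < s <= b -> s != c -> F s = 0) ->
  finite_set (`]0, a] `&` F @^-1` [set~ 0]) ->
  finite_set (`]0, b] `&` F @^-1` [set~ 0]) /\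
  \sum_(s \in `]0, b]) F s = \sum_(s \in `]0, a]) F s + F c.
Proof.
move=> a0 ac cb F0 fa.
have sub : `]0, b] `&` F @^-1` [set~ 0] `<=`
    (`]0, a] `&` F @^-1` [set~ 0]) `|` [set c].
  move=> s [] /=; rewrite !in_itv/= => /andP[s0 sb] Fs.
  have [sa|sa] := leP s a; first by left; rewrite s0.
  right; apply/eqP; apply: contra_notT Fs => sc.
  by rewrite F0// sa.
split; first by apply: sub_finite_set sub _; rewrite finite_setU; split.
have := @fsbigU0 V 0 +%R R _ [set c] F fa (finite_set1 c).
rewrite fsbig_set1 -fsbig_supp => <-; last first.
  by move=> s [[]] /= + _ sc; rewrite sc in_itv/= [c <= a]leNgt ac andbF.
apply/esym; apply: fsbig_widen.
  move=> s [[]/=|/= ->]; rewrite !in_itv/=; last by rewrite (le_lt_trans a0).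
  by move=> /andP[-> sa] _; rewrite (le_trans sa)// ltW// (lt_le_trans ac).
by move=> s [sb ns]; apply: contrapT => Fs; apply: ns; exact: sub.
Qed.

End sums_over_jumps.

Section observed_path.
Context {R : realType} {d : measure_display} {Omega : measurableType d}.
Context {n p : nat}.
Variables (x0 : 'rV[R]_p) (M : R -> Omega -> 'I_n).
Variables (Xi : 'I_n -> R -> Omega -> 'rV[R]_p) (w : Omega).

(** The hidden state and all the sources as a single path, so that a small
cell has at most one time at which any of them jumps. *)
Definition joint_path (t : R) := (M t w, fun i => Xi i t w).

Hypothesis joint_step : step_path joint_path.

Let dX s := \sum_i (M s w == i)%:R *: (Xi i s w - left_limit (Xi i ^~ w) s).

Let dXE s : dX s = Xi (M s w) s w - left_limit (Xi (M s w) ^~ w) s.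
Proof.
rewrite /dX (bigD1 (M s w))//= eqxx scale1r big1 ?addr0// => i /negPf iM.
by rewrite eq_sym iM scale0r.
Qed.

Let left_limit_cell a b c : a < c <= b ->
  (forall u, a <= u < c -> joint_path u = joint_path a) ->
  (forall u, c <= u <= b -> joint_path u = joint_path b) ->
  forall i s, a < s <= b ->
  left_limit (Xi i ^~ w) s = if s <= c then Xi i a w else Xi i b w.
Proof.
move=> /andP[ac cb] Pa Pb i s /andP[as_ sb]; case: (leP s c) => sc.
  apply: left_limit_cst; apply/near_leftP; exists (s - a); rewrite ?subr_gt0//.
  move=> u /andP[]; rewrite opprB addrCA subrr addr0 => au us.
  by have /(congr1 (fun P => P.2 i)) : joint_path u = joint_path a
    by apply: Pa; rewrite (ltW au)/= (lt_le_trans us).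
apply: left_limit_cst; apply/near_leftP; exists (s - c); rewrite ?subr_gt0//.
move=> u /andP[]; rewrite opprB addrCA subrr addr0 => cu us.
by have /(congr1 (fun P => P.2 i)) : joint_path u = joint_path b
  by apply: Pb; rewrite (ltW cu)/= (le_trans _ sb)// ltW.
Qed.

Let dX_cell a b c : a < c <= b ->
  (forall u, a <= u < c -> joint_path u = joint_path a) ->
  (forall u, c <= u <= b -> joint_path u = joint_path b) ->
  (forall s, a < s <= b -> s != c -> dX s = 0) /\
  dX c = Xi (M b w) b w - Xi (M b w) a w.
Proof.
move=> acb Pa Pb; have /andP[ac cb] := acb.
have PcE i : Xi i c w = Xi i b w.
  by have /(congr1 (fun P => P.2 i)) : joint_path c = joint_path b
    by apply: Pb; rewrite lexx cb.
split.
  move=> s /andP[as_ sb] sc; rewrite dXE (left_limit_cell acb)// ?as_//.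
  case: ifPn => [sc'|]; last rewrite -ltNge => cs.
    have : joint_path s = joint_path a by apply: Pa; rewrite ltW//= lt_neqAle sc.
    by move=> /(congr1 (fun P => P.2 (M s w)))/= ->; rewrite subrr.
  have : joint_path s = joint_path b by apply: Pb; rewrite ltW.
  by move=> /(congr1 (fun P => P.2 (M s w)))/= ->; rewrite subrr.
rewrite dXE (left_limit_cell acb)// ?lexx// PcE.
by have /(congr1 (fun P => P.1))/= -> : joint_path c = joint_path b
  by apply: Pb; rewrite lexx cb.
Qed.

Let fin_jumps t : 0 <= t -> finite_set (`]0, t] `&` dX @^-1` [set~ 0]).
Proof.
rewrite le_eqVlt => /predU1P[<-|t0].
  by rewrite set_itv_ge ?set0I// bnd_simp ltxx.
have [N _ /(_ N (leqnn N)) good] := step_path_grid joint_step t0.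
suff H l : (l <= N.+1)%N ->
    finite_set (`]0, grid t N l] `&` dX @^-1` [set~ 0]).
  by have := H N.+1 (leqnn _); rewrite grid_last.
elim: l => [_|l IH lN].
  by rewrite grid0 set_itv_ge ?set0I// bnd_simp ltxx.
have [c [acb Pa Pb]] := good l lN.
have [dX0 _] := dX_cell acb Pa Pb; case/andP: acb => ac cb.
by have [] := fsbig_oc_extend (grid_ge0 N l (ltW t0)) ac cb dX0 (IH (ltnW lN)).
Qed.

Let X := observation x0 M Xi.

Lemma observation0 : X 0 w = x0.
Proof.
by rewrite /X/observation set_itv_ge ?bnd_simp ?ltxx// fsbig_set0 addr0.
Qed.

(** On a cell with one jump of the joint path the hidden state at the jump is
the state at the right end point, so the observed increment is read off from
the end points alone. *)
Lemma observation_increment a b : 0 <= a -> a < b ->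
  one_jump_cell joint_path a b ->
  X b w - X a w = Xi (M b w) b w - Xi (M b w) a w.
Proof.
move=> a0 ab [c [acb Pa Pb]].
have [dX0 dXc] := dX_cell acb Pa Pb; case/andP: acb => ac cb.
have [_] := fsbig_oc_extend a0 ac cb dX0 (fin_jumps a0).
rewrite dXc {1}/dX => E.
by rewrite /X/observation E opprD addrACA subrr add0r addrAC subrr add0r.
Qed.

Let observation_cst a b : 0 <= a -> a <= b ->
  (forall u, a <= u <= b -> joint_path u = joint_path a) -> X b w = X a w.
Proof.
move=> a0; rewrite le_eqVlt => /predU1P[->//|ab] Pa.
have Pba : joint_path b = joint_path a by apply: Pa; rewrite ltW/=.
apply/eqP; rewrite -subr_eq0 observation_increment//; last first.
  exists b; split; first by rewrite ab lexx.
    by move=> u /andP[au ub]; apply: Pa; rewrite au ltW.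
  by move=> u /andP[bu ub]; congr joint_path; apply/eqP; rewrite eq_le ub bu.
by move: Pba => /(congr1 (fun P => P.2 (M b w)))/= ->; rewrite subrr.
Qed.

Lemma observation_one_jump a b : 0 <= a ->
  one_jump_cell joint_path a b -> one_jump_cell (X ^~ w) a b.
Proof.
move=> a0 [c [acb Pa Pb]]; exists c; split=> //.
  move=> u /andP[au uc]; apply: observation_cst => // v /andP[av vu].
  by apply: Pa; rewrite av (le_lt_trans vu).
move=> u /andP[cu ub]; apply/esym/observation_cst => //.
  by rewrite (le_trans a0)// (le_trans _ cu)// ltW//; case/andP: acb.
move=> v /andP[uv vb]; rewrite [RHS]Pb ?cu//; apply: Pb.
by rewrite (le_trans cu).
Qed.

Lemma observation_right_cst t : 0 <= t -> \forall u \near t^'+, X u w = X t w.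
Proof.
move=> t0; have /near_rightP[e e0 He] := joint_step.1 _ t0.
apply/near_rightP; exists e => // u /andP[tu ue].
apply: observation_cst => //; first exact: ltW.
move=> v /andP[]; rewrite le_eqVlt => /predU1P[<-//|tv vu].
by apply: He; rewrite tv (le_lt_trans vu).
Qed.

End observed_path.

Section jump_times.
Context {R : realType} {d : measure_display} {Omega : measurableType d}.
Context {p : nat}.
Variables (X : R -> Omega -> 'rV[R]_p) (w : Omega).

Local Notation sigma m := (jump_time X m w).

Lemma jump_time_leS m : (sigma m <= sigma m.+1)%E.
Proof.
by rewrite /=; apply: le_ereal_inf_tmp => _ [t [/ltW + _] <-].
Qed.

Lemma jump_time_le m m' : (m <= m')%N -> (sigma m <= sigma m')%E.
Proof.
elim: m' => [|m' IH]; first by rewrite leqn0 => /eqP ->.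
rewrite leq_eqVlt => /predU1P[->//|]; rewrite ltnS => /IH mm'.
exact: le_trans mm' (jump_time_leS m').
Qed.

Lemma jump_time_ge0 m : (0 <= sigma m)%E.
Proof. exact: (@jump_time_le 0). Qed.

Hypothesis Xr : forall t, 0 <= t -> \forall u \near t^'+, X u w = X t w.

Let no_jump_after t : 0 <= t -> exists2 e, 0 < e &
  forall u, t < u < t + e -> X u w = left_limit (X ^~ w) u.
Proof.
move=> t0; have /near_rightP[e e0 He] := Xr t0.
exists e => // u /andP[tu ue]; rewrite He ?tu//.
apply/esym/left_limit_cst/near_leftP; exists (u - t); rewrite ?subr_gt0//.
move=> v /andP[]; rewrite opprB addrCA subrr addr0 => tv vu.
by apply: He; rewrite tv (lt_trans vu).
Qed.

Let jump_time_gt m b : 0 <= b -> (forall u, u <= b -> (sigma m < u%:E)%E ->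
  X u w = left_limit (X ^~ w) u) -> (b%:E < sigma m.+1)%E.
Proof.
move=> b0 nj; have [e e0 He] := no_jump_after b0.
apply: (@lt_le_trans _ _ (b + e)%:E); first by rewrite lte_fin ltrDl.
apply: le_ereal_inf_tmp => _ [t [mt /eqP jt] <-]; rewrite lee_fin leNgt.
apply/negP => tbe; apply: jt; have [tb|bt] := leP t b; first exact: nj.
by apply: He; rewrite bt.
Qed.

Let no_jump_before m a u : (a%:E < sigma m.+1)%E -> u <= a ->
  (sigma m < u%:E)%E -> X u w = left_limit (X ^~ w) u.
Proof.
move=> am ua mu; apply/eqP; apply: contraTT am => jt; rewrite -leNgt.
apply: le_trans (_ : u%:E <= _)%E; last by rewrite lee_fin.
by apply: ereal_inf_lbound; exists u.
Qed.

Lemma jump_count0 : (sigma 0 <= 0%:E < sigma 1)%E.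
Proof.
apply/andP; split=> //; apply: jump_time_gt => // u u0.
by rewrite [sigma 0]/= lte_fin ltNge u0.
Qed.

(** The condition on k says that exactly k jumps have occurred by time a.
Crossing a cell keeps the count or, when the end points of the cell differ,
increases it by one. *)
Lemma jump_count_cell a b k : 0 <= a -> one_jump_cell (X ^~ w) a b ->
  (sigma k <= a%:E < sigma k.+1)%E ->
  if X a w == X b w then (sigma k <= b%:E < sigma k.+1)%E
  else (sigma k.+1 <= b%:E < sigma k.+2)%E.
Proof.
move=> a0 [c [/andP[ac cb] Xa Xb]] /andP[ka ak].
have b0 : 0 <= b by rewrite (le_trans a0)// (le_trans (ltW ac)).
have nj u : a < u <= b -> u != c -> X u w = left_limit (X ^~ w) u.
  move=> /andP[au ub] uc; apply/esym/left_limit_cst/near_leftP.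
  have [{}uc|cu] := ltP u c.
    exists (u - a); rewrite ?subr_gt0// => v /andP[].
    rewrite opprB addrCA subrr addr0 => av vu.
    by rewrite !Xa// ?(ltW au)// (ltW av) (lt_trans vu).
  exists (u - c); rewrite ?subr_gt0 ?lt_neqAle 1?eq_sym ?uc// => v /andP[].
  rewrite opprB addrCA subrr addr0 => cv vu.
  by rewrite !Xb// ?cu// (ltW cv)/= (le_trans (ltW vu)).
have Xc : X c w = X b w by apply: Xb; rewrite lexx.
have lc : left_limit (X ^~ w) c = X a w.
  apply/left_limit_cst/near_leftP; exists (c - a); rewrite ?subr_gt0//.
  move=> v /andP[]; rewrite opprB addrCA subrr addr0 => av vc.
  by apply: Xa; rewrite ltW.
have ab : (a%:E <= b%:E)%E by rewrite lee_fin (le_trans (ltW ac)).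
case: eqP => Xab.
  rewrite (le_trans ka ab) andTb; apply: jump_time_gt => // u ub ku.
  have [ua|au] := leP u a; first exact: no_jump_before ak _ ku.
  have [->|uc] := eqVneq u c; last by apply: nj; rewrite ?au.
  by rewrite Xc lc.
have kc : sigma k.+1 = c%:E.
  apply/eqP; rewrite eq_le; apply/andP; split.
    apply: ereal_inf_lbound; exists c => //; split.
      by rewrite (le_lt_trans ka)// lte_fin.
    by rewrite Xc lc eq_sym; apply/eqP.
  apply: le_ereal_inf_tmp => _ [u [ku /eqP ju] <-]; rewrite lee_fin leNgt.
  apply/negP => uc; apply: ju; have [ua|au] := leP u a.
    exact: no_jump_before ak _ ku.
  by apply: nj; rewrite ?au ?(lt_eqF uc)// (le_trans (ltW uc)).
rewrite kc lee_fin cb andTb; apply: jump_time_gt => // u ub.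
rewrite kc lte_fin => cu; apply: nj; last by rewrite gt_eqF.
by rewrite ub (lt_trans ac).
Qed.

Lemma jump_time_le_count m k t : (sigma k <= t%:E < sigma k.+1)%E ->
  (sigma m <= t%:E)%E = (m <= k)%N.
Proof.
move=> /andP[kt tk]; case: leqP => mk.
  by rewrite (le_trans (jump_time_le mk)).
by apply/negbTE; rewrite -ltNge (lt_le_trans tk)// jump_time_le.
Qed.

End jump_times.

(** * Measurability of vectors, of the observation and of its jump times *)

Section measurable_vectors.
Context {R : realType} {p : nat}.
Context {ds : measure_display} {S : measurableType ds}.
Implicit Types f g : S -> 'rV[R]_p.

(** An open set is the union of the countably many rational boxes that it
contains. *)
Lemma measurable_rV f :
  (forall j, measurable_fun [set: S] (fun w => f w ord0 j)) ->
  forall B, euclidean_sets p B -> measurable (f @^-1` B).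
Proof.
move=> mf B mB; rewrite -[X in measurable X]setTI.
suff /(_ measurableT B mB) : measurable_fun [set: S] (f : S -> borelRV R p) by [].
apply: (@measurability _ _ S (borelRV R p) _ _ (@open (matrix R 1 p)) erefl) => _ [U oU <-]; rewrite setTI.
pose box (qk : 'rV[rat]_p * nat) : set 'rV[R]_p :=
  [set x | forall j, `|x ord0 j - ratr (qk.1 ord0 j)| < qk.2.+1%:R^-1].
have -> : f @^-1` U = \bigcup_qk
    (if `[< box qk `<=` U >] then f @^-1` box qk else set0).
  apply/seteqP; split=> w; last first.
    by move=> [qk _]; case: ifPn => // /asboolP sub; exact: sub.
  move=> Ufw; have /nbhs_ballP[e /= e0 He] : nbhs (f w) U by exact: open_nbhs_nbhs.
  have [k _ Hk] := grid_mesh_lt (1 : R) (divr_gt0 e0 (ltr0n _ 2)).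
  have {}Hk : k.+1%:R^-1 < e / 2 by have := Hk k (leqnn k); rewrite div1r.
  have k0 : 0 < k.+1%:R^-1 :> R by rewrite invr_gt0.
  have /choice[q Hq] : forall j, exists q : rat,
      `|f w ord0 j - ratr q| < k.+1%:R^-1.
    move=> j; have [|q] := @rat_in_itvoo R (f w ord0 j) (f w ord0 j + k.+1%:R^-1).
      by rewrite ltrDl.
    rewrite in_itv/= => /andP[q1 q2]; exists q.
    by rewrite distrC gtr0_norm ?subr_gt0// ltrBlDl.
  exists (\row_j q j, k) => //.
  have bw : box (\row_j q j, k) (f w) by move=> j /=; rewrite mxE.
  case: ifPn => // /asboolP; apply: contra_notP => _ x bx; apply: He.
  split=> // i j; rewrite (ord1 i) /ball/=.
  rewrite -(subrKA (ratr (q j))) (le_lt_trans (ler_normD _ _))//.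
  have := bx j; have := bw j; rewrite /= mxE => h1 h2.
  rewrite (_ : e = e / 2 + e / 2); last by rewrite -splitr.
  by apply: ltrD; [|rewrite distrC]; exact: lt_trans Hk.
apply: countable_bigcupT_measurable; first exact: countableP.
move=> qk; case: ifPn => _ //.
have -> : f @^-1` box qk = \bigcap_(j in [set: 'I_p])
    ((fun w => `|f w ord0 j - ratr (qk.1 ord0 j)|) @^-1` `]-oo, qk.2.+1%:R^-1[).
  by apply/seteqP; split=> w /= bw j => [_|]; have := bw j; rewrite /= in_itv/=;
    [exact|apply].
apply: fin_bigcap_measurable => // j _; rewrite -[X in measurable X]setTI.
apply: measurableT_comp => //.
by apply: measurable_funB.
Qed.

Lemma measurable_rV_coord f :
  (forall B, euclidean_sets p B -> measurable (f @^-1` B)) ->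
  forall j, measurable_fun [set: S] (fun w => f w ord0 j).
Proof.
move=> mf j; apply: (measurability _ (RGenOpens.measurableE R)).
move=> _ [_ [a [b ->]] <-]; rewrite setTI.
have -> : (fun w => f w ord0 j) @^-1` `]a, b[ =
    f @^-1` ((fun x : 'rV[R]_p => x ord0 j) @^-1` `]a, b[) by [].
apply: mf; apply: sub_sigma_algebra.
by apply: open_comp => // x _; exact: coord_continuous.
Qed.

Lemma measurable_rV_neq f g :
  (forall j, measurable_fun [set: S] (fun w => f w ord0 j)) ->
  (forall j, measurable_fun [set: S] (fun w => g w ord0 j)) ->
  measurable [set w | f w != g w].
Proof.
move=> mf mg.
have -> : [set w | f w != g w] = \bigcup_(j in [set: 'I_p])
    ((fun w => f w ord0 j - g w ord0 j) @^-1` (~` [set 0])).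
  apply/seteqP; split=> w /=.
    apply: contraNP => nfg; apply/eqP/rowP => j; apply/eqP; rewrite -subr_eq0.
    by apply/eqP; apply: contrapT => fg; apply: nfg; exists j.
  by move=> [j _] fg; apply: contra_not_neq fg => ->; rewrite subrr.
apply: fin_bigcup_measurable => // j _; rewrite -[X in measurable X]setTI.
by apply: measurable_funB => //; apply: measurableC.
Qed.

Lemma measurable_eventually (A : set S) (A_ : (set S)^nat) :
  (forall k, measurable (A_ k)) ->
  (forall w, \forall k \near \oo, A_ k w <-> A w) -> measurable A.
Proof.
move=> mA AE.
have -> : A = \bigcup_k \bigcap_(l in [set l | (k <= l)%N]) A_ l.
  apply/seteqP; split=> [w Aw|w [k _ H]].
    by have [k _ Hk] := AE w; exists k => // l kl; apply/(Hk l).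
  have [l _ Hl] := AE w.
  by apply/(Hl (maxn k l)); [exact: leq_maxr|apply: H; exact: leq_maxl].
by apply: bigcup_measurable => k _; apply: bigcap_measurableType.
Qed.

End measurable_vectors.

Section generated_sigma_algebras.
Context {R : realType} {p : nat}.

Lemma sigma_of_gen {Omega S : Type} (G : set_system S) (J : set R)
    (Z : R -> Omega -> S) u B : J u -> G B -> sigma_of G J Z (Z u @^-1` B).
Proof. by move=> Ju GB; apply: sub_gen_smallest; exists u, B. Qed.

Lemma sigma_of_sub {Omega S : Type} (G : set_system S) (J J' : set R)
    (Z : R -> Omega -> S) : J `<=` J' -> sigma_of G J Z `<=` sigma_of G J' Z.
Proof.
move=> JJ'; apply: sub_sigma_algebra2 => A [u [B [Ju GB ->]]].
by exists u, B; split=> //; exact: JJ'.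
Qed.

Lemma sigma_of_measurable {Omega S : Type} (G : set_system S) (J : set R)
    (Z : R -> Omega -> S) (F : set_system Omega) : sigma_algebra setT F ->
  (forall u B, J u -> G B -> F (Z u @^-1` B)) -> sigma_of G J Z `<=` F.
Proof.
by move=> sF JF; apply: smallest_sub => // A [u [B [Ju GB ->]]]; exact: JF.
Qed.

Context {d : measure_display} {Omega : measurableType d}.

Lemma sigma_of_coord (J : set R) (Z : R -> Omega -> 'rV[R]_p)
  (S := g_sigma_algebraType
    [set A | exists u B, [/\ J u, euclidean_sets p B & A = Z u @^-1` B]]) u :
  J u -> forall j, measurable_fun [set: S] (fun w => Z u w ord0 j).
Proof.
move=> Ju; apply: (@measurable_rV_coord R p _ S (Z u)) => B mB.
exact: sigma_of_gen.
Qed.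

Lemma sigma_of_neq (J : set R) (Z : R -> Omega -> 'rV[R]_p) u v :
  J u -> J v -> sigma_of (euclidean_sets p) J Z [set w | Z u w != Z v w].
Proof.
move=> Ju Jv; pose S := g_sigma_algebraType
  [set A | exists u B, [/\ J u, euclidean_sets p B & A = Z u @^-1` B]].
by apply: (@measurable_rV_neq R p _ S (Z u) (Z v)); exact: sigma_of_coord.
Qed.

End generated_sigma_algebras.

Section compound_sums.
Context {R : realType} {p : nat}.
Context {ds : measure_display} {S : measurableType ds}.

(** Stated over an arbitrary measurable space S: it serves for the events of the
model and for the smaller sigma-algebra generated by the past counts and the
marks. *)
Lemma compound_sum_measurable (N : S -> nat) (Y : nat -> S -> 'rV[R]_p) :
  (forall k, measurable (N @^-1` [set k])) ->
  (forall k B, euclidean_sets p B -> measurable (Y k @^-1` B)) ->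
  forall B, euclidean_sets p B ->
    measurable ((fun w => \sum_(k < N w) Y k w) @^-1` B).
Proof.
move=> mN mY B mB.
have -> : (fun w => \sum_(k < N w) Y k w) @^-1` B =
    \bigcup_n ((N @^-1` [set n]) `&` (fun w => \sum_(k < n) Y k w) @^-1` B).
  apply/seteqP; split=> w /=; first by move=> ?; exists (N w).
  by move=> [n _ [/= <-]].
apply: bigcup_measurable => n _; apply: measurableI => //.
apply: measurable_rV => // j.
under eq_fun do rewrite summxE.
by apply: measurable_sum => k; apply: measurable_rV_coord => C mC; exact: mY.
Qed.

End compound_sums.

Section grid_changes.
Context {R : realType} {d : measure_display} {Omega : measurableType d}.
Context {p : nat}.
Variables (X : R -> Omega -> 'rV[R]_p).

Definition grid_change (t : R) (n l : nat) (w : Omega) : bool :=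
  X (grid t n l) w != X (grid t n l.+1) w.

Lemma grid_change_count t w :
  (forall u, 0 <= u -> \forall v \near u^'+, X v w = X u w) -> 0 < t ->
  forall n, (forall l, (l < n.+1)%N ->
     one_jump_cell (X ^~ w) (grid t n l) (grid t n l.+1)) ->
  forall l, (l <= n.+1)%N ->
  let k := (\sum_(j < l) grid_change t n j w)%N in
  (jump_time X k w <= (grid t n l)%:E < jump_time X k.+1 w)%E.
Proof.
move=> Xr t0 n good; elim=> [_|l IH ln].
  rewrite big_ord0 grid0; exact: jump_count0.
rewrite big_ord_recr; set k := (\sum_(i < l) _)%N.
have := jump_count_cell Xr (grid_ge0 n l (ltW t0)) (good l ln) (IH (ltnW ln)).
rewrite -/k -/(grid_change t n l w) /grid_change.
by case: eqP => _ /=; rewrite ?addn0 ?addn1.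
Qed.

End grid_changes.

Section observed_filtration.
Context {R : realType} {d : measure_display} {Omega : measurableType d}.
Context {n p : nat}.
Variables (x0 : 'rV[R]_p) (M : R -> Omega -> 'I_n).
Variables (Xi : 'I_n -> R -> Omega -> 'rV[R]_p).
Hypothesis joint_step : forall w, step_path (joint_path M Xi w).
Local Notation X := (observation x0 M Xi).

Lemma observation_grid t w : 0 < t -> \forall N \near \oo,
  (forall l, (l < N.+1)%N ->
     one_jump_cell (X ^~ w) (grid t N l) (grid t N l.+1)) /\
  (forall l, (l < N.+1)%N ->
     X (grid t N l.+1) w - X (grid t N l) w =
     Xi (M (grid t N l.+1) w) (grid t N l.+1) w -
     Xi (M (grid t N l.+1) w) (grid t N l) w).
Proof.
move=> t0; have := step_path_grid (joint_step w) t0; apply: filterS => N good.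
split=> l lN.
  apply: observation_one_jump => //; first exact/grid_ge0/ltW.
  exact: good.
apply: observation_increment => //; first exact/grid_ge0/ltW.
  exact: grid_lt_succ.
exact: good.
Qed.

Lemma observation_jump_count t w : 0 <= t ->
  exists k, (jump_time X k w <= t%:E < jump_time X k.+1 w)%E.
Proof.
rewrite le_eqVlt => /predU1P[<-|t0].
  by exists 0%N; apply: jump_count0 => u; exact: observation_right_cst.
have [N _ /(_ N (leqnn N))[good _]] := observation_grid w t0.
eexists; rewrite -[t in X in X%:E](grid_last t N).
by apply: (grid_change_count _ t0 good) => // u; exact: observation_right_cst.
Qed.

Hypothesis M_meas : forall t i, 0 <= t -> measurable (M t @^-1` [set i]).
Hypothesis Xi_meas : forall i t B, 0 <= t -> euclidean_sets p B ->
  measurable (Xi i t @^-1` B).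

(** The observation is the limit of Riemann sums over grids, which are
eventually constant along each path. *)
Lemma observation_measurable t B : 0 <= t -> euclidean_sets p B ->
  measurable (X t @^-1` B).
Proof.
move=> t0 mB; apply: measurable_rV => // j; move: t0.
rewrite le_eqVlt => /predU1P[<-|t0].
  rewrite (_ : (fun w => _) = cst (x0 ord0 j)); first exact: measurable_cst.
  by apply/funext => w; rewrite observation0.
pose h N w := x0 ord0 j + \sum_(l < N.+1) \sum_i
  \1_(M (grid t N l.+1) @^-1` [set i]) w *
  (Xi i (grid t N l.+1) w ord0 j - Xi i (grid t N l) w ord0 j).
apply: (@measurable_fun_cvg _ _ _ _ h) => [N|w _].
  apply: measurable_funD => //; apply: measurable_sum => l.
  apply: measurable_sum => i; apply: measurable_funM.
    apply: measurable_indic; apply: M_meas; exact/grid_ge0/ltW.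
  by apply: measurable_funB; apply: measurable_rV_coord => C mC;
    apply: Xi_meas => //; exact/grid_ge0/ltW.
apply: cvg_near_cst; have := observation_grid w t0.
apply: filterS => N [_ inc]; rewrite /h.
have -> : X t w = x0 + \sum_(l < N.+1)
    (X (grid t N l.+1) w - X (grid t N l) w).
  rewrite -(big_mkord xpredT (fun l => X (grid t N l.+1) w - X (grid t N l) w)).
  by rewrite telescope_sumr// grid0 observation0 grid_last addrC subrK.
rewrite mxE summxE; congr (_ + _); apply: eq_bigr => l _.
rewrite inc// (bigD1 (M (grid t N l.+1) w))//= big1 ?addr0.
  by rewrite indicE mem_set//= mul1r !mxE.
by move=> i /negP iM; rewrite indicE memNset ?mul0r//= => /esym/eqP.
Qed.

Lemma observation_filtration_measurable t A : 0 <= t ->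
  observation_filtration X t A -> measurable A.
Proof.
move=> t0; apply: sigma_of_measurable; first exact: sigma_algebra_measurable.
move=> u B /=; rewrite in_itv/= => /andP[u0 _].
exact: observation_measurable.
Qed.

(** The filtration at time t consists of events decided by the values of X on
[0, t] only; the jumps up to time t are seen there because, on a fine enough
grid of [0, t], they are as many as the changes between grid points. *)
Lemma jump_time_stopping m t : 0 <= t ->
  observation_filtration X t [set w | (jump_time X m w <= t%:E)%E].
Proof.
rewrite le_eqVlt => /predU1P[<-|t0].
  case: m => [|m].
    rewrite (_ : [set _ | _] = setT); first exact: (@measurableT _ (g_sigma_algebraType _)).
    by apply/seteqP; split=> // w _; exact: lexx.
  rewrite (_ : [set _ | _] = set0); first exact: (@measurable0 _ (g_sigma_algebraType _)).
  apply/seteqP; split=> // w; rewrite /mkset.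
  have c0 := @jump_count0 R d Omega p X w (observation_right_cst x0 (joint_step w)).
  by rewrite (jump_time_le_count _ c0).
pose A_ N := [set w | (m <= \sum_(l < N.+1) grid_change X t N l w)%N].
apply: (@measurable_eventually _ (g_sigma_algebraType _) _ A_); last first.
  move=> w; have := observation_grid w t0; apply: filterS => N [good _].
  have Xr u : 0 <= u -> \forall v \near u^'+, X v w = X u w.
    exact: observation_right_cst.
  have := grid_change_count Xr t0 good (leqnn _).
  by rewrite /= grid_last => /jump_time_le_count ->.
move=> N; set S := g_sigma_algebraType _.
pose h (w : S) : R := \sum_(l < N.+1) \1_[set w | grid_change X t N l w] w.
rewrite (_ : A_ N = h @^-1` `[m%:R, +oo[); last first.
  have hE w : h w = (\sum_(l < N.+1) grid_change X t N l w)%:R.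
    rewrite natr_sum; apply: eq_bigr => l _; rewrite indicE; congr (_ %:R).
    by congr nat_of_bool; apply/idP/idP; rewrite inE.
  by apply/seteqP; split=> w; rewrite /A_ /= in_itv/= andbT hE ler_nat.
rewrite -[X in measurable X]setTI.
suff : measurable_fun [set: S] h by apply.
apply: measurable_sum => l; apply: measurable_indic.
apply: sigma_of_neq => /=; rewrite in_itv/= grid_ge0 ?grid_le// ?ltW//.
exact: ltnW.
Qed.

End observed_filtration.

(** * Right-continuous processes at random times *)

Section integrals_of_processes.
Context {R : realType} {d : measure_display} {Omega : measurableType d}.
Implicit Types (Z : R -> Omega -> R).

(** The value at t is the limit of the values at the next points to the right
of t in the grids of mesh 1 / N.+1, and these are countably valued in t. *)
Lemma right_continuous_measurable Z :
  (forall u, 0 <= u -> measurable_fun [set: Omega] (Z u)) ->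
  (forall w t, 0 <= t -> Z u w @[u --> t^'+] --> Z t w) ->
  measurable_fun [set: R * Omega] (fun z => Z (Num.max z.1 0) z.2).
Proof.
move=> mZ cZ.
pose up N (x : R) : R := (Num.truncn (x * N.+1%:R)).+1%:R / N.+1%:R.
pose h N (z : R * Omega) := Z (up N (Num.max z.1 0)) z.2.
have max0 (x : R) : 0 <= Num.max x 0 by rewrite le_max lexx orbT.
apply: (@measurable_fun_cvg _ _ _ _ h) => [N|[t w] _].
  move=> _ B mB; rewrite setTI.
  have -> : h N @^-1` B = \bigcup_k
      ([set t : R | Num.truncn (Num.max t 0 * N.+1%:R) = k] `*`
       (Z (k.+1%:R / N.+1%:R) @^-1` B)).
    by apply/seteqP; split=> [[t w] /= Bh|[t w] [k _ [/= <-]]//]; eexists.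
  apply: bigcup_measurable => k _; apply: measurableX.
    have -> : [set t : R | Num.truncn (Num.max t 0 * N.+1%:R) = k] =
        (fun t => Num.max t 0 * N.+1%:R) @^-1` `[k%:R, k.+1%:R[.
      apply/seteqP; split=> t /=; rewrite in_itv/= -truncn_eq ?mulr_ge0//.
        by move=> ->.
      by move=> /eqP.
    rewrite -[X in measurable X]setTI.
    suff : measurable_fun [set: R] (fun t : R => Num.max t 0 * N.+1%:R) by apply.
    by apply: measurable_funM => //; exact: measurable_maxr.
  by rewrite -[X in measurable X]setTI; apply: mZ => //; rewrite divr_ge0.
have /cvg_at_rightP := cZ w _ (max0 t).
move=> /(_ (fun N => up N (Num.max t 0))); apply; set x := Num.max t 0.
have up_itv N : x < up N x <= x + 1 / N.+1%:R.
  have /andP[lo hi] := truncn_itv (mulr_ge0 (max0 t) (ler0n R N.+1)).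
  rewrite /up ltr_pdivlMr// hi/= ler_pdivrMr// mulrDl divfK//.
  by rewrite -natr1 lerD2r.
split; first by move=> N; case/andP: (up_itv N).
apply/cvgrPdist_lt => e e0; have := grid_mesh_lt 1 e0; apply: filterS => N HN.
have /andP[lo hi] := up_itv N; rewrite ltr0_norm ?subr_lt0// opprB ltrBlDl.
by rewrite (le_lt_trans hi)// ltrD2l.
Qed.

(** Tonelli's theorem, applied to the positive and to the negative part. *)
Lemma measurable_integral_random_time (Y : R * Omega -> R) (theta : Omega -> R) :
  measurable_fun [set: R * Omega] Y -> measurable_fun [set: Omega] theta ->
  measurable_fun [set: Omega]
    (fun w => \int[lebesgue_measure]_(t in `[0, theta w]) Y (t, w)).
Proof.
move=> mY mtheta.
pose g (z : Omega * R) : \bar R :=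
  ((Y (z.2, z.1) * \1_(`[0, theta z.1]) z.2)%R)%:E.
have mg : measurable_fun [set: Omega * R] g.
  apply/measurable_EFinP; apply: measurable_funM.
    have -> : (fun z : Omega * R => Y (z.2, z.1)) = Y \o (fun z => (z.2, z.1)) by [].
    apply: measurableT_comp => //.
    by apply: measurable_fun_pair; [exact: measurable_snd|exact: measurable_fst].
  have -> : (fun z : Omega * R => \1_(`[0, theta z.1]) z.2 : R) =
      \1_[set z : Omega * R | 0 <= z.2 <= theta z.1].
    apply/funext => z; rewrite !indicE.
    apply: (congr1 (fun b : bool => b%:R)).
    by apply/idP/idP; rewrite !inE /=.
  apply: measurable_indic.
  have -> : [set z : Omega * R | 0 <= z.2 <= theta z.1] =
      (fun z : Omega * R => z.2) @^-1` `[0, +oo[ `&`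
      (fun z : Omega * R => theta z.1 - z.2) @^-1` `[0, +oo[.
    apply/seteqP; split=> z /=; rewrite !in_itv/= !andbT subr_ge0.
      by move=> /andP[].
    by move=> [-> ->].
  apply: measurableI; rewrite -[X in measurable X]setTI.
    suff : measurable_fun [set: Omega * R] (fun z : Omega * R => z.2) by apply.
    exact: measurable_snd.
  suff : measurable_fun [set: Omega * R] (fun z : Omega * R => theta z.1 - z.2).
    by apply.
  apply: measurable_funB; last exact: measurable_snd.
  by apply: measurableT_comp => //; exact: measurable_fst.
have E w : (\int[lebesgue_measure]_(t in `[0, theta w]) Y (t, w))%R =
    fine (fubini_F lebesgue_measure g^\+%E w -
          fubini_F lebesgue_measure g^\-%E w)%E.
  rewrite /Rintegral integral_mkcond integralE; congr (fine (_ - _)%E);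
    apply: eq_integral => t _; rewrite ?funeposE ?funenegE /g patchE/= indicE;
    by case: ifPn; rewrite ?mulr1 ?mulr0.
rewrite (_ : (fun w => _) = fun w => fine (fubini_F lebesgue_measure g^\+%E w -
          fubini_F lebesgue_measure g^\-%E w)%E); last exact/funext.
apply: (measurableT_comp (f := fine)); first exact: fine_measurable.
apply: emeasurable_funB; apply: measurable_fun_fubini_tonelli_F => //.
  exact: measurable_funepos.
exact: measurable_funeneg.
Qed.

Lemma Rintegral_increment (f : R -> R) (a b K K0 : R) : 0 <= a -> a <= b ->
  measurable_fun `[0, b] f -> (forall t, 0 <= t <= b -> `|f t| <= K0) ->
  (forall t, a <= t <= b -> `|f t| <= K) ->
  `| \int[lebesgue_measure]_(t in `[0, b]) f t -
     \int[lebesgue_measure]_(t in `[0, a]) f t | <= K * (b - a).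
Proof.
move=> a0 ab mf f0 fK.
have intf : lebesgue_measure.-integrable `[0, b] (EFin \o f).
  have fin0 : (lebesgue_measure (`[0%R, b]%classic : set R) < +oo)%E.
    by rewrite lebesgue_measure_itv/=; case: ifPn => // _; rewrite -EFinB ltry.
  apply: measurable_bounded_integrable => //.
  exists K0; split; first exact: num_real.
  by move=> x K0x t /=; rewrite in_itv/= => /f0/le_trans; apply; exact: ltW.
rewrite Rintegral_itvB ?bnd_simp//.
have sub : `]a, b] `<=` `[0, b].
  move=> t /=; rewrite !in_itv/= => /andP[at_ ->].
  by rewrite (le_trans a0)// ltW.
have intf' : lebesgue_measure.-integrable `]a, b] (EFin \o f).
  exact: integrableS intf.
apply: (le_trans (le_normr_Rintegral _ _)) => //.
have fin : (lebesgue_measure (`]a, b]%classic : set R) < +oo)%E.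
  by rewrite lebesgue_measure_itv/=; case: ifPn => // _; rewrite -EFinB ltry.
have -> : K * (b - a) = \int[lebesgue_measure]_(t in `]a, b]) K.
  have mE : lebesgue_measure (`]a, b]%classic : set R) = (b - a)%:E.
    rewrite lebesgue_measure_itv/= lte_fin.
    by case: ltgtP ab => // -> _; rewrite subrr.
  by rewrite Rintegral_cst//; congr (K * _); exact: (esym (congr1 fine mE)).
apply: le_Rintegral => //.
- exact: (@integrable_norm _ _ _ lebesgue_measure `]a, b] f).
- apply: measurable_bounded_integrable => //.
  by exists `|K|; split=> [|x Kx t _]; [exact: num_real|exact: ltW].
- by move=> t /=; rewrite in_itv/= => /andP[at_ tb]; apply: fK; rewrite tb ltW.
Qed.

End integrals_of_processes.

(** * The flow of conditional laws between jumps *)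

Section unit_interval_variables.
Context {R : realType} {d : measure_display} {Omega : measurableType d}.
Variable P : probability Omega R.

Lemma unit_interval_integrable (f : Omega -> R) : measurable_fun setT f ->
  (forall w, 0 <= f w <= 1) -> P.-integrable setT (EFin \o f).
Proof.
move=> mf f01; apply: measurable_bounded_integrable => //.
  by rewrite -ge0_fin_numE// fin_num_measure.
exists 1; split; first exact: num_real.
move=> x x1 w _ /=; have /andP[f0 f1] := f01 w.
by rewrite ger0_norm// (le_trans f1)// ltW.
Qed.

Lemma unit_interval_expectation_fin (f : Omega -> R) : measurable_fun setT f ->
  (forall w, 0 <= f w <= 1) -> 'E_P[f]%E \is a fin_num.
Proof.
move=> mf f01; rewrite unlock; apply: integrable_fin_num => //.
exact: unit_interval_integrable.
Qed.

Lemma unit_interval_expectation_cvg (f_ : nat -> Omega -> R) (f : Omega -> R) :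
  (forall k, measurable_fun setT (f_ k)) -> measurable_fun setT f ->
  (forall k w, 0 <= f_ k w <= 1) -> (forall w, 0 <= f w <= 1) ->
  (forall w, f_ k w @[k --> \oo] --> f w) ->
  fine ('E_P[f_ k])%E @[k --> \oo] --> fine ('E_P[f])%E.
Proof.
move=> mf_ mf f01_ f01 f_f; apply: fine_cvg.
rewrite fineK; last exact: unit_interval_expectation_fin.
rewrite !unlock.
have [] // := @dominated_convergence _ _ _ P setT measurableT
  (fun k w => (f_ k w)%:E) (fun w => (f w)%:E) (cst 1%E).
- by move=> k; exact/measurable_EFinP.
- exact/measurable_EFinP.
- by apply: aeW => w _; apply: cvg_EFin; [exact: nearW|exact: f_f].
- exact: finite_measure_integrable_cst.
- apply: aeW => w k _ /=; rewrite lee_fin; have /andP[f0 f1] := f01_ k w.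
  by rewrite ger0_norm.
Qed.

End unit_interval_variables.

Section flow_properties.
Context {R : realType} {d : measure_display} {Omega : measurableType d}.
Context {n : nat}.
Variables (lambda : 'I_n -> R) (M : R -> Omega -> 'I_n).
Hypothesis lambda_ge0 : forall i, 0 <= lambda i.
Hypothesis M_meas : forall t i, 0 <= t -> measurable (M t @^-1` [set i]).
Hypothesis M_right : forall w t, 0 <= t ->
  \forall u \near t^'+, M u w = M t w.

Let L := \sum_i lambda i.
Let rate s w := \sum_i lambda i * (M s w == i)%:R.

Let rate_ge0 s w : 0 <= rate s w.
Proof. by apply: sumr_ge0 => i _; rewrite mulr_ge0. Qed.

Let rate_le s w : rate s w <= L.
Proof. by apply: ler_sum => i _; rewrite ler_piMr// lern1 leq_b1. Qed.

Let rate_bound s w : `|rate s w| <= L.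
Proof. by rewrite ger0_norm. Qed.

Lemma state_measurable t i : 0 <= t ->
  measurable_fun [set: Omega] (fun w => (M t w == i)%:R : R).
Proof.
move=> t0; rewrite (_ : (fun w => _) = \1_(M t @^-1` [set i])).
  by apply: measurable_indic; exact: M_meas.
apply/funext => w; rewrite indicE; apply: (congr1 (fun b : bool => b%:R)).
by apply/idP/idP; rewrite inE => /eqP.
Qed.

Let rate_joint : measurable_fun [set: R * Omega]
  (fun z => rate (Num.max z.1 0) z.2).
Proof.
apply: right_continuous_measurable => [u u0|w t t0].
  by apply: measurable_sum => i; apply: measurable_funM => //;
    exact: state_measurable.
apply: cvg_near_cst; have := M_right w t0.
by apply: filterS => u Mu; rewrite /rate Mu.
Qed.

Let rateE t w : cumulative_rate lambda M t w =
  \int[lebesgue_measure]_(s in `[0, t]) rate (Num.max s 0) w.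
Proof.
apply: eq_Rintegral => s; rewrite inE/= in_itv/= => /andP[s0 _].
by rewrite /rate (max_idPl s0).
Qed.

Lemma cumulative_rate_measurable t :
  measurable_fun [set: Omega] (cumulative_rate lambda M t).
Proof.
rewrite (_ : cumulative_rate lambda M t = fun w =>
  \int[lebesgue_measure]_(s in `[0, t]) rate (Num.max s 0) w).
  exact: (measurable_integral_random_time rate_joint (measurable_cst t)).
by apply/funext => w; rewrite rateE.
Qed.

Lemma cumulative_rate_ge0 t w : 0 <= cumulative_rate lambda M t w.
Proof. by apply: Rintegral_ge0 => s _; exact: rate_ge0. Qed.

Let cumulative_rate_incr t u w : 0 <= t -> t <= u ->
  `|cumulative_rate lambda M u w - cumulative_rate lambda M t w| <= L * (u - t).
Proof.
move=> t0 tu; rewrite !rateE.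
apply: (@Rintegral_increment _ (fun s => rate (Num.max s 0) w) t u L L) => //.
apply: measurable_funTS.
exact: (measurable_fun_pair1 w rate_joint).
Qed.

Let cumulative_rate_cvg w t (u : R^nat) : 0 <= t -> (forall k, t < u k) ->
  u k @[k --> \oo] --> t ->
  cumulative_rate lambda M (u k) w @[k --> \oo] --> cumulative_rate lambda M t w.
Proof.
move=> t0 tu ut; apply: (@squeeze_cvgr _ _ _ _
    (fun k => cumulative_rate lambda M t w - L * (u k - t))
    (fun k => cumulative_rate lambda M t w + L * (u k - t))).
- apply: nearW => k.
  have := cumulative_rate_incr w t0 (ltW (tu k)).
  by rewrite ler_norml => /andP[h1 h2]; apply/andP; split; lra.
- rewrite -[X in _ --> X]subr0; apply: cvgB; first exact: cvg_cst.
  rewrite -[X in _ --> X](mulr0 L); apply: cvgM; first exact: cvg_cst.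
  by rewrite -[X in _ --> X](subrr t); apply: cvgB => //; exact: cvg_cst.
- rewrite -[X in _ --> X]addr0; apply: cvgD; first exact: cvg_cst.
  rewrite -[X in _ --> X](mulr0 L); apply: cvgM; first exact: cvg_cst.
  by rewrite -[X in _ --> X](subrr t); apply: cvgB => //; exact: cvg_cst.
Qed.

Let survival t w : R := expR (- cumulative_rate lambda M t w).

Let survival_measurable t : measurable_fun [set: Omega] (survival t).
Proof.
apply: measurableT_comp => //; apply: measurableT_comp => //.
exact: cumulative_rate_measurable.
Qed.

Let survival_ge0 t w : 0 <= survival t w. Proof. exact: expR_ge0. Qed.

Let survival_le1 t w : survival t w <= 1.
Proof. by rewrite -expR0 ler_expR oppr_le0 cumulative_rate_ge0. Qed.

Let joint_survival i t w : R := (M t w == i)%:R * survival t w.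

Let joint_survival_bound i t w : 0 <= joint_survival i t w <= 1.
Proof.
rewrite mulr_ge0//= -[leRHS]mulr1 ler_pM//.
by rewrite lern1 leq_b1.
Qed.

Let joint_survival_measurable i t : 0 <= t ->
  measurable_fun [set: Omega] (joint_survival i t).
Proof.
by move=> t0; apply: measurable_funM => //; exact: state_measurable.
Qed.

Variable P : probability Omega R.

Let survival_pos t : 0 <= t -> (0 < 'E_P[survival t])%E.
Proof.
move=> t0; apply: (@lt_le_trans _ _ (expR (- (L * t)))%:E).
  by rewrite lte_fin expR_gt0.
have <- : (\int[P]_w cst (expR (- (L * t)))%:E w = (expR (- (L * t)))%:E)%E.
  rewrite integral_cst//; apply: etrans (mule1 _); congr (_ * _)%E.
  exact: probability_setT.
rewrite unlock; apply: ge0_le_integral => //.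
- by move=> w _; rewrite lee_fin expR_ge0.
- by apply/measurable_EFinP; exact: survival_measurable.
- move=> w _; rewrite lee_fin ler_expR lerN2.
  have := cumulative_rate_incr w (lexx 0) t0; rewrite subr0.
  have -> : cumulative_rate lambda M 0 w = 0.
    by rewrite /cumulative_rate set_itv1 Rintegral_set1.
  by rewrite subr0 => /(le_trans (ler_norm _)).
Qed.

Let survival_bound t w : 0 <= survival t w <= 1.
Proof. by rewrite survival_ge0 survival_le1. Qed.

Let survival_fin t : 'E_P[survival t]%E \is a fin_num.
Proof. exact: unit_interval_expectation_fin. Qed.

Let joint_survival_fin i t : 0 <= t -> 'E_P[joint_survival i t]%E \is a fin_num.
Proof.
move=> t0; apply: unit_interval_expectation_fin => //.
exact: joint_survival_measurable.
Qed.

Let flow_law t : 'rV[R]_n := \row_i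
  (fine 'E_P[joint_survival i t] / fine 'E_P[survival t]).

(** The numerators sum to the denominator, which is positive, under any
probability P. *)
Lemma flow_law_simplex t : 0 <= t -> simplex n (flow_law t).
Proof.
move=> t0; have den0 : 0 < fine ('E_P[survival t]%E).
  by rewrite fine_gt0// survival_pos//= ltey_eq survival_fin.
split.
  move=> i; rewrite mxE divr_ge0 ?(ltW den0)// fine_ge0//.
  by apply: expectation_ge0 => w; case/andP: (joint_survival_bound i t w).
under eq_bigr do rewrite mxE.
rewrite -mulr_suml sum_fine; last by move=> i _; exact: joint_survival_fin.
suff -> : (\sum_i 'E_P[joint_survival i t] = 'E_P[survival t])%E.
  by rewrite divff// gt_eqF.
rewrite [in RHS]unlock; under eq_bigr do rewrite unlock.
rewrite -ge0_integral_sum//.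
- apply: eq_integral => w _; rewrite sumEFin; congr EFin.
  rewrite -mulr_suml (bigD1 (M t w))//= eqxx big1 ?addr0 ?mul1r//.
  by move=> i /negPf iM; rewrite eq_sym iM.
- by move=> i; apply/measurable_EFinP; exact: joint_survival_measurable.
- by move=> i w _; rewrite lee_fin; case/andP: (joint_survival_bound i t w).
Qed.

Lemma flow_law_right_continuous i t : 0 <= t ->
  flow_law u ord0 i @[u --> t^'+] --> flow_law t ord0 i.
Proof.
move=> t0; apply/cvg_at_rightP => u [tu ut].
have u0 k : 0 <= u k by rewrite (le_trans t0)// ltW.
have sv w : survival (u k) w @[k --> \oo] --> survival t w.
  apply: continuous_cvg; first exact: continuous_expR.
  by apply: cvgN; exact: cumulative_rate_cvg.
have den0 : 0 < fine ('E_P[survival t]%E).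
  by rewrite fine_gt0// survival_pos//= ltey_eq survival_fin.
under eq_fun do rewrite mxE; rewrite mxE.
apply: cvgM.
  apply: unit_interval_expectation_cvg => //.
  - by move=> k; exact: joint_survival_measurable.
  - exact: joint_survival_measurable.
  - move=> w; apply: cvgM => //; apply: cvg_near_cst.
    have /near_rightP[e e0 He] := M_right w t0.
    have := ut; move/cvgrPdist_lt => /(_ _ e0); apply: filterS => k uk.
    rewrite He// tu/=; move: uk.
    by rewrite ltr0_norm ?subr_lt0// opprB ltrBlDl.
apply: cvgV; first by rewrite gt_eqF.
exact: unit_interval_expectation_cvg.
Qed.

End flow_properties.

(** * Increments of compound Poisson processes *)

Section compound_poisson_increments.
Context {R : realType} {d : measure_display} {Omega : measurableType d}.
Context {p : nat}.
Variables (P : probability Omega R) (lambda : R) (N : R -> Omega -> nat).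
Variables (Y : nat -> Omega -> 'rV[R]_p).
Hypothesis lambda_gt0 : 0 < lambda.
Hypothesis HN : poisson_process P lambda N.
Hypothesis Y_meas : forall k B, euclidean_sets p B -> measurable (Y k @^-1` B).
Hypothesis indep : mutually_independent P (fun o : option nat =>
  if o is Some k then [set Y k @^-1` B | B in euclidean_sets p]
  else sigma_of_process setT N).

Let marks (K : nat) (B : nat -> set 'rV[R]_p) : set Omega :=
  [set w | forall k, (k < K)%N -> B k (Y k w)].

Let marks_measurable K B : (forall k, euclidean_sets p (B k)) ->
  measurable (marks K B).
Proof.
move=> mB; rewrite (_ : marks K B = \bigcap_(k in `I_K) (Y k @^-1` B k)).
  by apply: bigcap_measurableType => k _; exact: Y_meas.
by apply/seteqP; split=> w H k /=; exact: H.
Qed.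

Let counts_indep_marks K B : (forall k, euclidean_sets p (B k)) ->
  exists c, forall E, sigma_of_process setT N E ->
    P (E `&` marks K B) = (P E * c)%E.
Proof.
move=> mB; pose J := [fset Some (k : nat) | k in iota 0 K]%fset.
exists (\prod_(o <- J) P (if o is Some k then Y k @^-1` B k else setT))%E.
move=> E sE.
have NJ : None \notin J by apply/imfsetP => -[k].
have := indep (J := (None |` J)%fset)
  (A := fun o => if o is Some k then Y k @^-1` B k else E).
rewrite big_fsetU1//=.
rewrite (eq_big_seq (fun o => P (if o is Some k then Y k @^-1` B k else setT)));
  last by move=> [k|]; rewrite ?(negbTE NJ).
move=> <-.
  congr (P _); apply/seteqP; split=> w.
    move=> [Ew Bw] [k|]/= => [|//].
    rewrite !inE/= => /imfsetP[k' /= + [->]].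
    by rewrite mem_iota => /andP[_]; exact: Bw.
  move=> H; split; first by apply: (H None); rewrite /= !inE eqxx.
  move=> k kK; apply: (H (Some k)); rewrite /= !inE /=; apply/imfsetP.
  by exists k => //=; rewrite mem_iota.
by move=> [k|] //= _; exists (B k).
Qed.

(** A pi-system generating the joint information on the counts up to time u and
on all the marks, past and future. *)
Let past_and_marks (u : R) : set_system Omega :=
  [set A | exists E K B, [/\ natural_filtration setT N u E,
     forall k, euclidean_sets p (B k) & A = E `&` marks K B]].

Let past_measurable u : natural_filtration setT N u `<=` measurable.
Proof.
apply: sigma_of_measurable; first exact: sigma_algebra_measurable.
move=> r B /=; rewrite in_itv/= => /andP[r0 _] _; case: HN => mN _ _.
rewrite (_ : N r @^-1` B = \bigcup_(k in B) (N r @^-1` [set k])).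
  by apply: bigcup_measurable => k _; exact: mN.
by apply/seteqP; split=> w /=; [exists (N r w)|move=> [k Bk /= ->]].
Qed.

Let euclidean_setT : euclidean_sets p [set: 'rV[R]_p].
Proof. exact: (@measurableT _ (borelRV R p)). Qed.

Let past_and_marks_measurable u : past_and_marks u `<=` measurable.
Proof.
move=> A [E [K [B [sE mB ->]]]].
by apply: measurableI; [exact: past_measurable sE|exact: marks_measurable].
Qed.

Let past_and_marks_setI u : setI_closed (past_and_marks u).
Proof.
move=> _ _ [E [K [B [sE mB ->]]]] [E' [K' [B' [sE' mB' ->]]]].
exists (E `&` E'), (maxn K K'), (fun k => (if (k < K)%N then B k else setT) `&`
  (if (k < K')%N then B' k else setT)); split.
- exact: (@measurableI _ (g_sigma_algebraType _)).
- by move=> k; apply: (@measurableI _ (borelRV R p)); case: ifP => // _;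
    [exact: mB|exact: mB'].
apply/seteqP; split=> w.
  move=> [[Ew Bw] [E'w B'w]]; do 2 split=> //.
    by case: ifPn => // kK; exact: Bw.
  by case: ifPn => // kK; exact: B'w.
move=> [[Ew E'w] H]; split; split=> // k kK.
  by have [] := H k (leq_trans kK (leq_maxl _ _)); rewrite kK.
by have [_] := H k (leq_trans kK (leq_maxr _ _)); rewrite kK.
Qed.

Let no_arrival u v : set Omega := [set w | (N v w - N u w)%N = 0%N].

Let no_arrival_sigma u v : 0 <= u -> 0 <= v ->
  sigma_of_process setT N (no_arrival u v).
Proof.
move=> u0 v0; rewrite (_ : no_arrival u v = \bigcup_j \bigcup_k
    (if (k - j)%N == 0%N then N u @^-1` [set j] `&` N v @^-1` [set k] else set0)).
  apply: (@bigcupT_measurable _ (g_sigma_algebraType _)) => j.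
  apply: (@bigcupT_measurable _ (g_sigma_algebraType _)) => k.
  case: ifP => _; last exact: (@measurable0 _ (g_sigma_algebraType _)).
  apply: (@measurableI _ (g_sigma_algebraType _)).
    by apply: sigma_of_gen => //=; rewrite in_itv/= u0.
  by apply: sigma_of_gen => //=; rewrite in_itv/= v0.
apply/seteqP; split=> w.
  by move=> uv; exists (N u w) => //; exists (N v w) => //; rewrite uv eqxx.
by move=> [j _ [k _]]; case: eqP => // kj [/= uj vk]; rewrite /no_arrival/= uj vk.
Qed.

Let process_measurable : sigma_of_process setT N `<=` measurable.
Proof.
apply: sigma_of_measurable; first exact: sigma_algebra_measurable.
move=> r B /=; rewrite in_itv/= => /andP[r0 _] _.
apply: (@past_measurable r); apply: sigma_of_gen => //=.
by rewrite in_itv/= r0 lexx.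
Qed.

Let no_arrival_indep_gen u v : 0 <= u -> u < v -> forall A, past_and_marks u A ->
  P (A `&` no_arrival u v) = ((expR (- (lambda * (v - u))))%:E * P A)%E.
Proof.
move=> u0 uv _ [E [K [B [sE mB ->]]]]; have v0 := ltW (le_lt_trans u0 uv).
have [c Hc] := counts_indep_marks K mB.
have sE' : sigma_of_process setT N E.
  apply: sigma_of_sub sE => t /=; rewrite !in_itv/= andbT.
  by move=> /andP[].
rewrite setIAC Hc; last first.
  apply: (@measurableI _ (g_sigma_algebraType _)) => //.
  exact: no_arrival_sigma.
rewrite Hc//; case: HN => _ _ /(_ u v 0%N E u0 uv sE) ->.
rewrite /poisson_pmf mulr_gt0 ?subr_gt0// expr0 fact0 invr1 !mul1r.
by rewrite -muleA muleCA.
Qed.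

Let no_arrival_indep u v A : 0 <= u -> u < v -> <<s past_and_marks u>> A ->
  P (A `&` no_arrival u v) = ((expR (- (lambda * (v - u))))%:E * P A)%E.
Proof.
move=> u0 uv sA; have v0 := ltW (le_lt_trans u0 uv).
have mD : measurable (no_arrival u v).
  by apply: process_measurable; exact: no_arrival_sigma.
(* Both sides are finite measures in A that agree on the pi-system. *)
pose c := NngNum (expR_ge0 (- (lambda * (v - u)))).
apply: (@g_sigma_algebra_measure_unique _ R Omega (past_and_marks u)
  (@past_and_marks_measurable u) (fun=> setT) _ _
  (mrestr P mD) (mscale c P)) => //.
- move=> _; exists setT, 0%N, (fun=> setT); split=> //.
  + exact: (@measurableT _ (g_sigma_algebraType _)).
  + by apply/seteqP; split.
- by apply/seteqP; split=> // w _; exists 0%N.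
- exact: no_arrival_indep_gen.
- move=> _; change (P (setT `&` no_arrival u v) < +oo)%E.
  by rewrite -ge0_fin_numE// setTI; exact: fin_num_measure.
Qed.

(** A change of the compound sum over [u, v] requires an arrival in [u, v], and
arrivals after u are independent of the arrivals before u together with all
the marks. *)
Lemma compound_sum_change (Z : R -> Omega -> 'rV[R]_p) u v A :
  (forall t w, 0 <= t -> Z t w = \sum_(k < N t w) Y k w) ->
  0 <= u -> u < v -> natural_filtration (euclidean_sets p) Z u A ->
  (P (A `&` [set w | Z v w != Z u w]) <=
   (1 - expR (- (lambda * (v - u))))%:E * P A)%E.
Proof.
move=> ZE u0 uv sA; have v0 := ltW (le_lt_trans u0 uv).
have sA' : <<s past_and_marks u>> A.
  move: sA; apply: sigma_of_measurable => [|r B /=].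
    exact: smallest_sigma_algebra.
  rewrite in_itv/= => /andP[r0 ru] mB.
  rewrite (_ : Z r = fun w => \sum_(k < N r w) Y k w); last first.
    by apply/funext => w; exact: ZE.
  apply: (@compound_sum_measurable R p _ (g_sigma_algebraType (past_and_marks u))
    (N r) Y) => // [k|k C mC]; apply: sub_sigma_algebra.
    exists (N r @^-1` [set k]), 0%N, (fun=> setT); split=> //.
      by apply: sigma_of_gen => //=; rewrite in_itv/= r0.
    by apply/seteqP; split=> [w Hw|w []].
  exists setT, k.+1, (fun j => if j == k then C else setT); split=> //.
  - exact: (@measurableT _ (g_sigma_algebraType _)).
  - by move=> j; case: eqP.
  - apply/seteqP; split=> w /=.
      by move=> Cw; split=> // j _; case: eqP => // ->.
    by move=> [_ /(_ k (ltnSn k))]; rewrite eqxx.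
have mA : measurable A.
  by move: sA'; apply: smallest_sub => //; exact: sigma_algebra_measurable.
have mD : measurable (no_arrival u v).
  by apply: process_measurable; exact: no_arrival_sigma.
have mZ t B : 0 <= t -> euclidean_sets p B -> measurable (Z t @^-1` B).
  move=> t0 mB; rewrite (_ : Z t = fun w => \sum_(k < N t w) Y k w); last first.
    by apply/funext => w; exact: ZE.
  by apply: compound_sum_measurable => // k; case: HN => + _ _; apply.
apply: (@le_trans _ _ (P (A `\` no_arrival u v))).
  apply: le_measure; rewrite ?inE.
  - by apply: measurableI => //; apply: (@measurable_rV_neq R p _ Omega) => j;
      apply: measurable_rV_coord => B mB; exact: mZ.
  - exact: measurableD.
  - move=> w [Aw /eqP Zuv]; split=> // uv0; apply: Zuv; rewrite !ZE//.
    suff -> : N v w = N u w by [].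
    case: HN => _ /(_ w)[_ Nnd _] _; apply/eqP; rewrite eqn_leq.
    by rewrite -subn_eq0; apply/andP; split; [apply/eqP|apply: Nnd => //; exact: ltW].
rewrite measureD//; last by rewrite -ge0_fin_numE//; exact: fin_num_measure.
rewrite [X in (_ - X)%E](no_arrival_indep u0 uv sA').
rewrite EFinB muleBl ?mul1e//; exact: fin_num_measure.
Qed.

End compound_poisson_increments.

(** * Observed changes on a grid *)

Section trial_prefixes.
Context {d : measure_display} {Omega : measurableType d}.
Variable bit : nat -> Omega -> bool.

Definition trial_prefix (b : nat -> bool) (l : nat) : set Omega :=
  [set w | forall j, (j < l)%N -> bit j w = b j].

Lemma trial_prefix_measurable b l : (forall j, measurable [set w | bit j w]) ->
  measurable (trial_prefix b l).
Proof.
move=> mbit; rewrite (_ : trial_prefix b l = \bigcap_(j in `I_l)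
    (if b j then [set w | bit j w] else ~` [set w | bit j w])).
  by apply: bigcap_measurableType => j _; case: ifP => _ //; apply: measurableC.
apply/seteqP; split=> w H j /= jl; have := H j jl.
  by case: (b j) => /= [->|/negbT/negP].
by case: (b j) => /= [//|/negP/negbTE].
Qed.

End trial_prefixes.

Section independence.
Context {R : realType} {d : measure_display} {Omega : measurableType d}.

(** Independence lets a factor be changed in one event only. *)
Lemma mutually_independent_scale (P : probability Omega R) {I : choiceType}
    (FF : I -> set_system Omega) (J : {fset I}) (i0 : I) (A A' : I -> set Omega)
    (p : R) : mutually_independent P FF -> i0 \in J ->
  (forall i, FF i (A i)) -> (forall i, FF i (A' i)) ->
  (forall i, i != i0 -> A' i = A i) -> (P (A' i0) <= p%:E * P (A i0))%E ->
  (P (\bigcap_(i in [set` J]) A' i) <= p%:E * P (\bigcap_(i in [set` J]) A i))%E.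
Proof.
move=> ind i0J FA FA' AA' pA; rewrite !ind//.
rewrite (big_fsetD1 i0 i0J)/= [in leRHS](big_fsetD1 i0 i0J)/=.
rewrite muleA (_ : (\prod_(i <- (J `\ i0)%fset) P (A' i) =
  \prod_(i <- (J `\ i0)%fset) P (A i))%E); last first.
  by apply: eq_big_seq => i; rewrite !inE => /andP[ii0 _]; rewrite AA'.
by apply: lee_wpmul2r => //; apply: prode_ge0 => i _.
Qed.

(** The law of total probability, in the form of an inequality between two
events that holds given each value of a finitely valued variable. *)
Lemma probability_le_partition (P : probability Omega R) {I : finType}
    (f : Omega -> I) (A B : set Omega) (p : R) :
  (forall i, measurable (f @^-1` [set i])) -> measurable A -> measurable B ->
  (forall i, (P (A `&` f @^-1` [set i]) <= p%:E * P (B `&` f @^-1` [set i]))%E) ->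
  (P A <= p%:E * P B)%E.
Proof.
move=> mf mA mB AB.
have E C : measurable C -> P C = (\sum_(i \in [set: I]) P (C `&` f @^-1` [set i]))%E.
  move=> mC; rewrite -[in LHS](_ : \bigcup_(i in [set: I]) (C `&` f @^-1` [set i]) = C).
    rewrite content_fin_bigcup//.
    - exact: finite_finset.
    - by move=> i j _ _ [w [[_ /= <-] [_ /= <-]]].
    - by move=> i _; apply: measurableI => //; exact: mf.
    - apply: fin_bigcup_measurable => [|i _]; first exact: finite_finset.
      by apply: measurableI => //; exact: mf.
  by apply/seteqP; split=> [w [i _ []]//|w Cw]; exists (f w).
rewrite !E// ge0_mule_fsumr; last by move=> i; exact: measure_ge0.
by apply: lee_fsum => [|i _]; [exact: finite_finset|exact: AB].
Qed.

End independence.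

Section hidden_markov_changes.
Context {R : realType} {d : measure_display} {Omega : measurableType d}.
Context {n p : nat}.
Variables (P : probability Omega R) (Q : 'M[R]_n) (lambda : 'I_n -> R).
Variables (nu : 'I_n -> probability (borelRV R p) R) (pi : 'rV[R]_n).
Variables (M : R -> Omega -> 'I_n) (Xi : 'I_n -> R -> Omega -> 'rV[R]_p).
Hypothesis lambda_gt0 : forall i, 0 < lambda i.
Hypothesis model : hidden_markov_model P Q lambda nu pi M Xi.

Lemma hidden_measurable t i : 0 <= t -> measurable (M t @^-1` [set i]).
Proof. by case: model => -[mM _ _ _] _ _; exact: mM. Qed.

Lemma source_measurable i t B : 0 <= t -> euclidean_sets p B ->
  measurable (Xi i t @^-1` B).
Proof.
case: model => _ /(_ i)[N [Y [[mN _ _] mY _ ZE]]] _ t0 mB.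
rewrite (_ : Xi i t = fun w => \sum_(k < N t w) Y k w); last first.
  by apply/funext => w; exact: ZE.
apply: compound_sum_measurable => // [k|k C mC]; first exact: mN.
by have [] := mY k C mC.
Qed.

Lemma hidden_step_path w : step_path (M ^~ w).
Proof. by case: model => -[_ /(_ w)[] ]. Qed.

Lemma source_step_path i w : step_path (Xi i ^~ w).
Proof.
case: model => _ /(_ i)[N [Y [[_ /(_ w)[_ Nnd Nr] _] _ _ ZE]]] _.
apply: (@step_path_image _ _ _ (N ^~ w) (fun m => \sum_(k < m) Y k w)).
  by move=> t t0; exact: ZE.
exact: step_path_counting.
Qed.

Lemma joint_step_path w : step_path (joint_path M Xi w).
Proof.
apply: step_path_pair; first exact: hidden_step_path.
by apply: step_path_family => i; exact: source_step_path.
Qed.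

Variables (t : R) (N : nat).
Hypothesis t_gt0 : 0 < t.
Local Notation g := (grid t N).

Definition source_change i l (w : Omega) : bool := Xi i (g l.+1) w != Xi i (g l) w.

Definition state_change l w : bool := source_change (M (g l.+1) w) l w.

Local Notation change_prefix := (trial_prefix state_change).

Let g_ge0 l : 0 <= g l. Proof. exact/grid_ge0/ltW. Qed.

Lemma state_change_measurable l : measurable [set w | state_change l w].
Proof.
rewrite (_ : [set w | _] = \bigcup_(i in [set: 'I_n])
    (M (g l.+1) @^-1` [set i] `&` [set w | Xi i (g l.+1) w != Xi i (g l) w])).
  apply: fin_bigcup_measurable => // i _; apply: measurableI.
    exact: hidden_measurable.
  by apply: (@measurable_rV_neq R p _ Omega) => j; apply: measurable_rV_coord => B mB;
    exact: source_measurable.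
apply/seteqP; split=> w; first by move=> ?; exists (M (g l.+1) w).
by move=> [i _ [/= <-]].
Qed.

Let change_prefix_measurable b l : measurable (change_prefix b l).
Proof. by apply: trial_prefix_measurable; exact: state_change_measurable. Qed.

Let states (w : Omega) : {ffun 'I_N.+1 -> 'I_n} := [ffun j : 'I_N.+1 => M (g j.+1) w].

(** For the states iota at the grid points, the part of the prefix b that
concerns source i: the cells j < l with iota j = i. *)
Let source_prefix (iota : {ffun 'I_N.+1 -> 'I_n}) (b : nat -> bool) l i : set Omega :=
  [set w | forall j, (j < l)%N -> iota (inord j) = i -> source_change i j w = b j].

Let source_prefix_past iota b l i :
  natural_filtration (euclidean_sets p) (Xi i) (g l) (source_prefix iota b l i).
Proof.
rewrite (_ : source_prefix iota b l i = \bigcap_(j in `I_l)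
  (if iota (inord j) == i then
     if b j then [set w | Xi i (g j.+1) w != Xi i (g j) w]
     else ~` [set w | Xi i (g j.+1) w != Xi i (g j) w]
   else setT)).
  apply: (@bigcap_measurableType _ (g_sigma_algebraType _)) => j /= jl.
  have mj : natural_filtration (euclidean_sets p) (Xi i) (g l)
      [set w | Xi i (g j.+1) w != Xi i (g j) w].
    by apply: sigma_of_neq; rewrite /= in_itv/= g_ge0 grid_mono ?(ltW t_gt0)//;
        exact: ltnW.
  case: eqP => _; last exact: (@measurableT _ (g_sigma_algebraType _)).
  by case: ifP => // _; exact: (@measurableC _ (g_sigma_algebraType _)).
apply/seteqP; split=> w H j /= jl.
  case: eqP => // ij; have := H j jl ij; rewrite /source_change.
  by case: (b j) => /= [->|/negbT/negP].
move=> ij; have := H j jl; rewrite ij eqxx /source_change.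
by case: (b j) => /= [//|/negP/negbTE].
Qed.

Let states_sigma iota : sigma_of_process setT M (states @^-1` [set iota]).
Proof.
rewrite (_ : _ @^-1` _ = \bigcap_(j in [set: 'I_N.+1]) (M (g j.+1) @^-1` [set iota j])).
  apply: (@fin_bigcap_measurable _ (g_sigma_algebraType _)) => // j _.
  by apply: sigma_of_gen => //=; rewrite in_itv/= g_ge0.
apply/seteqP; split=> w /=; first by move=> <- j _; rewrite ffunE.
by move=> H; apply/ffunP => j; rewrite ffunE; exact: H.
Qed.

Lemma source_change_past i l A :
  natural_filtration (euclidean_sets p) (Xi i) (g l) A ->
  (P (A `&` [set w | source_change i l w]) <=
   (1 - expR (- (lambda i * (t / N.+1%:R))))%:E * P A)%E.
Proof.
case: model => _ /(_ i)[K [Y [HK mY ind ZE]]] _ sA.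
have := @compound_sum_change R d Omega p P (lambda i) K Y (lambda_gt0 i) HK
  (fun k B mB => (mY k B mB).1) ind (Xi i) (g l) (g l.+1) A ZE (g_ge0 l).
by rewrite grid_step; apply => //; exact: grid_lt_succ.
Qed.

Variable lbar : R.
Hypothesis lambda_le : forall i, lambda i <= lbar.

Let q := 1 - expR (- (lbar * (t / N.+1%:R))).

(** Given the states at the grid points, the cells are governed by independent
sources, and whatever happened on the earlier cells the next one shows a change
with probability at most q. *)
Lemma state_change_prefix b l : (l < N.+1)%N ->
  (P (change_prefix b l `&` [set w | state_change l w]) <=
   q%:E * P (change_prefix b l))%E.
Proof.
move=> lN; apply: (probability_le_partition (f := states)).
- move=> iota; have := states_sigma iota.
  apply: sigma_of_measurable; first exact: sigma_algebra_measurable.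
  move=> u B /=; rewrite in_itv/= andbT => u0 _.
  rewrite (_ : M u @^-1` B = \bigcup_(k in B) (M u @^-1` [set k])).
    apply: fin_bigcup_measurable => [|k _]; first exact: finite_finset.
    exact: hidden_measurable.
  by apply/seteqP; split=> w /=; [exists (M u w)|move=> [k Bk /= ->]].
- by apply: measurableI; [exact: change_prefix_measurable|exact: state_change_measurable].
- exact: change_prefix_measurable.
move=> iota; pose i0 := iota (inord l).
pose J := [fset o | o in enum {: option 'I_n}]%fset.
have oJ o : o \in J by apply/imfsetP; exists o => //=; rewrite mem_enum.
pose A o := if o is Some i then source_prefix iota b l i else states @^-1` [set iota].
pose A' o := if o is Some i then
    if i == i0 then source_prefix iota b l i `&` [set w | source_change i l w]
    else source_prefix iota b l i
  else states @^-1` [set iota].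
have Mg w j : states w = iota -> (j < N.+1)%N -> M (g j.+1) w = iota (inord j).
  by move=> <- jN; rewrite ffunE inordK.
have -> : change_prefix b l `&` states @^-1` [set iota] = \bigcap_(o in [set` J]) A o.
  apply/seteqP; split=> w.
    move=> [Hw sw] [i|] _ //= j jl ji.
    by rewrite -ji -Hw// /state_change Mg// (ltn_trans jl).
  move=> Hw; have sw : states w = iota by have := Hw None (oJ _).
  split=> // j jl; have jN := ltn_trans jl lN.
  have := Hw (Some (iota (inord j))) (oJ _) j jl erefl.
  by rewrite /state_change Mg.
have -> : change_prefix b l `&` [set w | state_change l w] `&`
    states @^-1` [set iota] = \bigcap_(o in [set` J]) A' o.
  apply/seteqP; split=> w.
    move=> [[Hw lw] sw] [i|] _ //=.
    have Hi : source_prefix iota b l i w.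
      move=> j jl ji; rewrite -ji -Hw// /state_change Mg//.
      exact: ltn_trans lN.
    by case: eqP => // ii; split=> //=; move: lw; rewrite ii /= /state_change Mg.
  move=> Hw; have sw : states w = iota by have := Hw None (oJ _).
  have Hi i : source_prefix iota b l i w.
    by have := Hw (Some i) (oJ _); rewrite /A'; case: eqP => // _ [].
  split=> //; split.
    move=> j jl; have jN := ltn_trans jl lN.
    by have := Hi (iota (inord j)) j jl erefl; rewrite /state_change Mg.
  have := Hw (Some i0) (oJ _); rewrite /A' eqxx => -[_] /=.
  by rewrite /state_change Mg.
have sub i : natural_filtration (euclidean_sets p) (Xi i) (g l.+1) `<=`
    sigma_of_process (euclidean_sets p) (Xi i).
  by apply: sigma_of_sub => u /=; rewrite !in_itv/= andbT => /andP[].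
have past i : natural_filtration (euclidean_sets p) (Xi i) (g l.+1)
    (source_prefix iota b l i).
  have := @source_prefix_past iota b l i; apply: sigma_of_sub => u /=.
  by rewrite !in_itv/= => /andP[-> ul]; rewrite (le_trans ul)// grid_mono// ltW.
apply: (@mutually_independent_scale R d Omega P _ _ J (Some i0)) => //.
- by case: model => _ _; exact.
- by move=> [i|] /=; [apply: sub; exact: past|exact: states_sigma].
- move=> [i|] /=; last exact: states_sigma.
  case: eqP => _; last by apply: sub; exact: past.
  apply: sub; apply: (@measurableI _ (g_sigma_algebraType _) _ _ (past i)).
  have g01 l' : (l' <= l.+1)%N -> `[0, g l.+1]%classic (g l').
    by move=> ll; rewrite /= in_itv/= g_ge0 grid_mono// ltW.
  exact: (@sigma_of_neq R p d Omega `[0, g l.+1]%classic (Xi i) (g l.+1) (g l)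
    (g01 _ (leqnn _)) (g01 _ (leqnSn _))).
- by move=> [i|] //= ii0; case: eqP => // ii; rewrite ii eqxx in ii0.
- rewrite /A' eqxx /A /=; apply: (le_trans (source_change_past (@source_prefix_past iota b l i0))).
  apply: lee_wpmul2r => //; rewrite lee_fin lerD2l lerN2 ler_expR lerN2.
  by rewrite ler_wpM2r// divr_ge0// ltW.
Qed.

End hidden_markov_changes.

(** * Discounted waiting times for successes *)

Section discounted_hits.
Context {R : realType}.

(** The discount factor r ^ k, where k is the number of steps until the m-th
success among the trials l, l + 1, ..., l + n - 1, and 0 if there are fewer
than m successes. *)
Fixpoint discounted_hit (r : R) (b : nat -> bool) (n l m : nat) : R :=
  if m is m'.+1 then
    if n is n'.+1 then
      r * (if b l then discounted_hit r b n' l.+1 m'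
           else discounted_hit r b n' l.+1 m)
    else 0
  else 1.

Lemma discounted_hit0 r b n l : discounted_hit r b n l 0 = 1.
Proof. by case: n. Qed.

Lemma discounted_hit_bound r b n l m : 0 <= r <= 1 ->
  0 <= discounted_hit r b n l m <= 1.
Proof.
move=> /andP[r0 r1]; elim: n l m => [|n IH] l [|m] /=; rewrite ?ler01 ?lexx//.
have bnd : 0 <= (if b l then discounted_hit r b n l.+1 m
           else discounted_hit r b n l.+1 m.+1) <= 1 by case: ifP.
case/andP: bnd => b0 b1; rewrite mulr_ge0//=.
by rewrite -[leRHS]mulr1 ler_pM.
Qed.

Context {d : measure_display} {Omega : measurableType d}.
Variables (P : probability Omega R) (bit : nat -> Omega -> bool).
Hypothesis bit_meas : forall l, measurable [set w | bit l w].

Lemma discounted_hit_measurable r n l m :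
  measurable_fun [set: Omega] (fun w => discounted_hit r (bit ^~ w) n l m).
Proof.
elim: n l m => [|n IH] l [|m] /=; try exact: measurable_cst.
apply: measurable_funM => //; apply: measurable_fun_ifT => //.
apply: (measurable_fun_bool true); rewrite setTI.
by rewrite (_ : _ @^-1` _ = [set w | bit l w])//; apply/seteqP; split.
Qed.

Local Notation prefix := (trial_prefix bit).

Let prefix_meas b l : measurable (prefix b l).
Proof. exact: trial_prefix_measurable. Qed.

Let prefix_extend b l c : exists b', prefix b' l.+1 = prefix b l `&` [set w | bit l w = c].
Proof.
exists (fun j => if (j < l)%N then b j else c); apply/seteqP; split=> w.
  move=> H; split; last by have := H l (ltnSn l); rewrite ltnn.
  by move=> j jl; have := H j (ltnW jl); rewrite jl.
move=> [H lc] j; rewrite ltnS leq_eqVlt => /predU1P[->|jl]; first by rewrite ltnn.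
by rewrite jl H.
Qed.

Variables (N : nat) (q r beta : R).
Hypothesis r01 : 0 <= r <= 1.
Hypothesis beta01 : 0 <= beta <= 1.
Hypothesis r_beta : r * (q + (1 - q) * beta) <= beta.
Hypothesis success : forall b l, (l < N)%N ->
  (P (prefix b l `&` [set w | bit l w]) <= q%:E * P (prefix b l))%E.

(** When each trial succeeds with probability at most q whatever the earlier
ones did, r ^ k / beta ^ j, with j the number of successes among the first k
trials, is a supermartingale; stopping it at the m-th success bounds the
discount factor by beta ^ m. *)
Lemma integral_discounted_hit n l m b : (l + n)%N = N ->
  (\int[P]_(w in prefix b l) (discounted_hit r (bit ^~ w) n l m)%:E <=
   (beta ^+ m)%:E * P (prefix b l))%E.
Proof.
have hit_ge0 n' l' m' w : (0 <= (discounted_hit r (bit ^~ w) n' l' m')%:E)%E.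
  by rewrite lee_fin; case/andP: (discounted_hit_bound (bit ^~ w) n' l' m' r01).
have r0 : 0 <= r by case/andP: r01.
have [b0 b1] := andP beta01.
have hit0 n' l' D : measurable D ->
    (\int[P]_(w in D) (discounted_hit r (bit ^~ w) n' l' 0)%:E <=
     (beta ^+ 0)%:E * P D)%E.
  move=> mD; rewrite (eq_integral (cst 1%E)); last first.
    by move=> w _; rewrite discounted_hit0.
  by rewrite integral_cst.
(* Each step splits the prefix according to the outcome of trial l. *)
elim: n l m b => [|n IH] l [|m] b lN; try exact/hit0/prefix_meas.
  by rewrite integral0_eq// mule_ge0// lee_fin exprn_ge0.
have lltN : (l < N)%N by rewrite -lN -addSnnS leq_addr.
have [bT ET] := prefix_extend b l true; have [bF EF] := prefix_extend b l false.
have PE : prefix b l = prefix bT l.+1 `|` prefix bF l.+1.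
  rewrite ET EF -setIUr -[LHS]setIT; congr (_ `&` _).
  by apply/seteqP; split=> w //= _; case: (bit l w); [left|right].
have disj : [disjoint prefix bT l.+1 & prefix bF l.+1].
  apply/disj_setPS => w; rewrite ET EF => -[[_ /= ->] [_ /=]] //.
have PU : P (prefix b l) = (P (prefix bT l.+1) + P (prefix bF l.+1))%E.
  by rewrite PE; apply: measureU; [exact: prefix_meas|exact: prefix_meas|exact/disj_set2P].
have mhit n' l' m' D : measurable_fun D
    (fun w => (discounted_hit r (bit ^~ w) n' l' m')%:E).
  by apply/measurable_EFinP/measurable_funTS; exact: discounted_hit_measurable.
rewrite PU [in leLHS]PE ge0_integral_setU;
  [|exact: prefix_meas|exact: prefix_meas|exact: mhit|by move=> *; exact: hit_ge0|exact: disj].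
have step c m' b' : prefix b' l.+1 = prefix b l `&` [set w | bit l w = c] ->
    m' = (if c then m else m.+1) ->
    (\int[P]_(w in prefix b' l.+1) (discounted_hit r (bit ^~ w) n.+1 l m.+1)%:E <=
     (r * beta ^+ m')%:E * P (prefix b' l.+1))%E.
  move=> E' m'E.
  rewrite (eq_integral (fun w => (r%:E *
    (discounted_hit r (bit ^~ w) n l.+1 m')%:E)%E)); last first.
    move=> w; rewrite inE E' => -[_ /= ->]; rewrite m'E.
    by case: c {E' m'E}.
  rewrite ge0_integralZl;
    [|exact: prefix_meas|exact: mhit|by move=> *; exact: hit_ge0|by rewrite lee_fin].
  rewrite EFinM -muleA; apply: lee_wpmul2l; first by rewrite lee_fin.
  by apply: IH; rewrite addSnnS.
apply: (le_trans (leeD (step true m bT ET erefl) (step false m.+1 bF EF erefl))).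
have PfE b' l' : P (prefix b' l') = (fine (P (prefix b' l')))%:E.
  by rewrite fineK//; apply: fin_num_measure; exact: prefix_meas.
have := success b lltN.
have -> : prefix b l `&` [set w | bit l w] = prefix bT l.+1 by rewrite ET.
rewrite PU (PfE bT) (PfE bF).
have x0 : 0 <= fine (P (prefix bT l.+1)) by exact: fine_ge0.
have y0 : 0 <= fine (P (prefix bF l.+1)) by exact: fine_ge0.
move: x0 y0; set x := fine _; set y := fine _ => x0 y0.
rewrite -[(x%:E + y%:E)%E]/((x + y)%:E) -!EFinM lee_fin => xy.
rewrite -[(_%:E + _%:E)%E]/((r * beta ^+ m * x + r * beta ^+ m.+1 * y)%:E) lee_fin.
rewrite exprSr; set B := beta ^+ m; have B0 : 0 <= B by exact: exprn_ge0.
have -> : r * B * x + r * (B * beta) * y =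
  B * (r * (beta * (x + y) + (1 - beta) * x)) by ring.
rewrite -mulrA ler_wpM2l//.
have h1 : r * (beta * (x + y) + (1 - beta) * x) <=
    r * ((q + (1 - q) * beta) * (x + y)).
  rewrite ler_wpM2l//.
  have : (1 - beta) * x <= (1 - beta) * (q * (x + y)).
    by rewrite ler_wpM2l// subr_ge0.
  by move=> ?; lra.
apply: (le_trans h1); rewrite mulrA ler_wpM2r//; exact: addr_ge0.
Qed.

Lemma expectation_discounted_hit m :
  ('E_P[fun w => discounted_hit r (bit ^~ w) N 0 m] <= (beta ^+ m)%:E)%E.
Proof.
have := @integral_discounted_hit N 0 m (fun=> true) (add0n N).
rewrite unlock (_ : prefix _ 0 = setT); last by apply/seteqP; split.
by rewrite [P setT]probability_setT mule1.
Qed.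

End discounted_hits.

Section jump_time_bound.
Context {R : realType} {d : measure_display} {Omega : measurableType d}.

(** The form in which jump times are known, which may be infinite: the events
s <= t for the times t >= 0 of the filtration. *)
Lemma measurable_ereal_rv (s : Omega -> \bar R) : (forall w, (0 <= s w)%E) ->
  (forall t, 0 <= t -> measurable [set w | (s w <= t%:E)%E]) ->
  measurable_fun [set: Omega] s.
Proof.
move=> s0 ms; apply: (measurability _ (ErealGenOInfty.measurableE R)).
move=> _ [_ [t ->] <-]; rewrite setTI.
have [t0|t0] := leP 0 t.
  rewrite (_ : _ @^-1` _ = ~` [set w | (s w <= t%:E)%E]).
    by apply: measurableC; exact: ms.
  apply/seteqP; split=> w /=; rewrite in_itv/= andbT ltNge; first by move/negP.
  by move/negP.
rewrite (_ : _ @^-1` _ = setT); first exact: measurableT.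
apply/seteqP; split=> w //= _; rewrite in_itv/= andbT.
by rewrite (lt_le_trans _ (s0 w))// lte_fin.
Qed.

Context {p : nat}.
Variables (X : R -> Omega -> 'rV[R]_p) (w : Omega).

(** On a grid so fine that every cell has at most one jump, the m-th jump falls
in the cell of the m-th grid change, hence not before one step earlier. *)
Lemma discounted_hit_ge (z t : R) N m : 0 <= z -> 0 < t ->
  (forall u, 0 <= u -> \forall v \near u^'+, X v w = X u w) ->
  (forall l, (l < N.+1)%N ->
     one_jump_cell (X ^~ w) (grid t N l) (grid t N l.+1)) ->
  (jump_time X m w <= t%:E)%E ->
  expR (- (z * (fine (jump_time X m w) + t / N.+1%:R))) <=
  discounted_hit (expR (- (z * (t / N.+1%:R)))) (grid_change X t N ^~ w) N.+1 0 m.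
Proof.
move=> z0 t0 Xr good mt; set h := t / N.+1%:R.
have h0 : 0 <= h by rewrite divr_ge0// ltW.
set r := expR (- (z * h)).
have mfin : jump_time X m w = (fine (jump_time X m w))%:E.
  rewrite fineK// ge0_fin_numE; last exact: jump_time_ge0.
  by rewrite (le_lt_trans mt)// ltry.
set s := fine _ in mfin *.
(* Induction on the number n of cells left; c is the number of jumps by the grid
   time l.  At c = m the waiting is over and only the location of the m-th jump
   in the last cell matters. *)
suff H n l c : (l + n)%N = N.+1 -> (c <= m)%N ->
    (jump_time X c w <= (grid t N l)%:E < jump_time X c.+1 w)%E \/ c = m ->
    ((c < m)%N -> (jump_time X c w <= (grid t N l)%:E < jump_time X c.+1 w)%E) ->
    (c = m -> grid t N l <= s + h) ->
    expR (- (z * (s + h - grid t N l))) <=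
    discounted_hit r (grid_change X t N ^~ w) n l (m - c).
  have c0 := jump_count0 Xr.
  have := H N.+1 0%N 0%N (add0n _) (leq0n _).
  rewrite grid0 !subr0 subn0; apply => //; first by left.
  move=> _; rewrite addr_ge0// -lee_fin -mfin; exact: jump_time_ge0.
elim: n l c => [|n IH] l c lN cm _ count gle.
  rewrite addn0 in lN; move: cm; rewrite leq_eqVlt => /predU1P[cm|cm].
    rewrite cm subnn discounted_hit0 -expR0 ler_expR oppr_le0 mulr_ge0//.
    by rewrite subr_ge0 gle.
  have /andP[_] := count cm; rewrite lN grid_last => tc.
  have := lt_le_trans tc (jump_time_le X w cm).
  by rewrite ltNge mt.
move: cm; rewrite leq_eqVlt => /predU1P[cm|cm].
  rewrite cm subnn discounted_hit0 -expR0 ler_expR oppr_le0 mulr_ge0//.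
  by rewrite subr_ge0 gle.
have lN1 : (l < N.+1)%N by rewrite -lN -addSnnS leq_addr.
have cl := count cm.
have gs : grid t N l.+1 = grid t N l + h by rewrite /h -(grid_step t N l) addrC subrK.
have -> : expR (- (z * (s + h - grid t N l))) =
    r * expR (- (z * (s + h - grid t N l.+1))).
  by rewrite -expRD gs; congr expR; ring.
rewrite -[(m - c)%N]prednK ?subn_gt0// [discounted_hit _ _ _ _ _]/=.
rewrite ler_wpM2l ?expR_ge0//.
have := jump_count_cell Xr (grid_ge0 N l (ltW t0)) (good l lN1) cl.
rewrite /grid_change; case: eqP => _ /= cl1.
  rewrite prednK ?subn_gt0//; apply: IH => //.
  - by rewrite addSnnS.
  - exact: ltnW.
  - by left.
  - by move=> cm'; rewrite cm' ltnn in cm.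
rewrite -subnS; apply: IH => //.
- by rewrite addSnnS.
- by left.
- move=> cm'; have /andP[_ lm] := cl.
  rewrite gs lerD2r -lee_fin -mfin -cm'; exact: ltW.
Qed.

End jump_time_bound.

(** * The Laplace transform of the observed jump times *)

Section jump_time_discount.
Context {R : realType}.

Lemma eq_discounted_hit (r : R) (b b' : nat -> bool) n l m :
  (forall j, (l <= j < l + n)%N -> b j = b' j) ->
  discounted_hit r b n l m = discounted_hit r b' n l m.
Proof.
elim: n l m => [|n IH] l [|m] //= bb'.
have bl : b l = b' l by apply: bb'; rewrite leqnn -addSnnS leq_addr.
have IH' m' : discounted_hit r b n l.+1 m' = discounted_hit r b' n l.+1 m'.
  apply: IH => j /andP[lj jl]; apply: bb'.
  by rewrite (ltnW lj) -addSnnS.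
by rewrite bl !IH'.
Qed.

Context {d : measure_display} {Omega : measurableType d}.
Context {n p : nat}.
Variables (P : probability Omega R) (Q : 'M[R]_n) (lambda : 'I_n -> R).
Variables (nu : 'I_n -> probability (borelRV R p) R) (pi : 'rV[R]_n).
Variables (M : R -> Omega -> 'I_n) (Xi : 'I_n -> R -> Omega -> 'rV[R]_p).
Variable x0 : 'rV[R]_p.
Hypothesis lambda_gt0 : forall i, 0 < lambda i.
Hypothesis model : hidden_markov_model P Q lambda nu pi M Xi.
Local Notation X := (observation x0 M Xi).

Lemma observed_jump_measurable m t : 0 <= t ->
  measurable [set w | (jump_time X m w <= t%:E)%E].
Proof.
move=> t0.
have jsp := joint_step_path model.
apply: (@observation_filtration_measurable R d Omega n p x0 M Xi jsp _ _ t) => //.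
- by move=> u i u0; exact: (hidden_measurable model).
- by move=> i u B u0 mB; exact: (source_measurable model).
- exact: jump_time_stopping.
Qed.

Lemma observed_jump_time_measurable m : measurable_fun [set: Omega] (jump_time X m).
Proof.
apply: measurable_ereal_rv; first by move=> w; exact: jump_time_ge0.
exact: observed_jump_measurable.
Qed.

Variables (lbar t z : R).
Hypothesis lambda_le : forall i, lambda i <= lbar.
Hypothesis lbar_gt0 : 0 < lbar.
Hypothesis t_gt0 : 0 < t.
Hypothesis z_ge0 : 0 <= z.

Definition discount_at_jump m (w : Omega) : R :=
  if (jump_time X m w <= t%:E)%E then expR (- (z * fine (jump_time X m w))) else 0.

Lemma discount_at_jump_bound m w : 0 <= discount_at_jump m w <= 1.
Proof.
rewrite /discount_at_jump; case: ifP => _; last by rewrite lexx ler01.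
rewrite expR_ge0 -expR0 ler_expR oppr_le0 mulr_ge0// fine_ge0//.
exact: jump_time_ge0.
Qed.

Lemma discount_at_jump_measurable m :
  measurable_fun [set: Omega] (discount_at_jump m).
Proof.
apply: measurable_fun_ifT => //.
  apply: (measurable_fun_bool true); rewrite setTI.
  rewrite (_ : _ @^-1` _ = [set w | (jump_time X m w <= t%:E)%E]).
    exact/observed_jump_measurable/ltW.
  by apply/seteqP; split.
apply: measurableT_comp => //; apply: measurableT_comp => //.
apply: measurable_funM => //.
apply: (measurableT_comp (f := fine)); first exact: fine_measurable.
exact: observed_jump_time_measurable.
Qed.

Let beta := lbar / (lbar + z).

Let beta01 : 0 <= beta <= 1.
Proof.
have s0 : 0 < lbar + z by rewrite ltr_wpDr.
by rewrite divr_ge0 ?(ltW s0) ?(ltW lbar_gt0)//= ler_pdivrMr// mul1r lerDl.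
Qed.

Let r N : R := expR (- (z * (t / N.+1%:R))).

Let r01 N : 0 <= r N <= 1.
Proof.
rewrite expR_ge0 -expR0 ler_expR oppr_le0 mulr_ge0//.
by rewrite divr_ge0// ltW.
Qed.

Let q N : R := 1 - expR (- (lbar * (t / N.+1%:R))).

(** After division by beta this is exp (- z h) (1 + q z / lbar) <= 1, which
holds because q <= lbar h. *)
Let r_beta N : r N * (q N + (1 - q N) * beta) <= beta.
Proof.
set h := t / N.+1%:R; have h0 : 0 <= h by rewrite divr_ge0// ltW.
have s0 : lbar + z != 0 by rewrite gt_eqF// ltr_wpDr.
have -> : q N + (1 - q N) * beta = beta * (1 + q N * (z / lbar)).
  by rewrite /beta; field; rewrite s0 gt_eqF.
rewrite mulrCA ler_piMr//; first by case/andP: beta01.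
rewrite /r expRN mulrC ler_pdivrMr ?expR_gt0// mul1r.
apply: le_trans (expR_ge1Dx (z * h)); rewrite lerD2l.
have -> : z * h = (lbar * h) * (z / lbar) by field; rewrite gt_eqF.
rewrite ler_wpM2r ?divr_ge0 ?(ltW lbar_gt0)//.
by have := expR_ge1Dx (- (lbar * h)); rewrite /q => ?; lra.
Qed.

Let hit N m w := discounted_hit (r N) ((state_change M Xi t N) ^~ w) N.+1 0 m.

Let hit_expectation N m : ('E_P[hit N m] <= (beta ^+ m)%:E)%E.
Proof.
apply: (expectation_discounted_hit _ (r01 N) beta01 (r_beta N)).
  by move=> l; exact: (state_change_measurable model).
move=> b l lN; exact: (state_change_prefix lambda_gt0 model).
Qed.

(** On fine grids the observed changes are the changes of the selected sources;
the factor compensates for the m-th jump being located up to one cell only. *)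
Let discount_le_hit m w : \forall N \near \oo,
  discount_at_jump m w <= expR (z * (t / N.+1%:R)) * hit N m w.
Proof.
have jsp := joint_step_path model.
have := observation_grid x0 jsp w t_gt0; apply: filterS => N [good inc].
rewrite /discount_at_jump; case: ifPn => [mt|_]; last first.
  rewrite mulr_ge0 ?expR_ge0//.
  by case/andP: (discounted_hit_bound ((state_change M Xi t N) ^~ w) N.+1 0 m (r01 N)).
have Xr u : 0 <= u -> \forall v \near u^'+, X v w = X u w.
  exact: observation_right_cst.
have := discounted_hit_ge z_ge0 t_gt0 Xr good mt.
rewrite (@eq_discounted_hit _ _ (fun l => state_change M Xi t N l w)); last first.
  move=> l /andP[_ lN]; rewrite /grid_change /state_change /source_change.
  by rewrite eq_sym -subr_eq0 inc// subr_eq0.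
rewrite -(ler_pM2l (expR_gt0 (z * (t / N.+1%:R)))) -expRD.
by apply: le_trans; rewrite ler_expR mulrDr opprD addrCA subrr addr0.
Qed.

(** Jumps are observed at a rate at most lbar, and the right-hand side is the
Laplace transform of a sum of m independent exponential variables of rate
lbar.  The bound passes to the limit from the grids, where it is that of a
waiting time for m successes. *)
Lemma expectation_discount_at_jump m :
  ('E_P[discount_at_jump m] <= (beta ^+ m)%:E)%E.
Proof.
pose c N : R := expR (z * (t / N.+1%:R)).
(* The minimum with the limit makes the grid bounds converge pointwise, and
   boundedly, to the discount at the jump. *)
pose G N w := Num.min (discount_at_jump m w) (c N * hit N m w).
have mhit N : measurable_fun setT (hit N m).
  apply: discounted_hit_measurable => l; exact: (state_change_measurable model).
have hit0 N w : 0 <= hit N m w <= 1 by exact: discounted_hit_bound.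
have mG N : measurable_fun setT (G N).
  apply: measurable_minr; first exact: discount_at_jump_measurable.
  exact: measurable_funM.
have G01 N w : 0 <= G N w <= 1.
  have /andP[f0 f1] := discount_at_jump_bound m w.
  rewrite /G le_min f0 mulr_ge0 ?expR_ge0//=; last by case/andP: (hit0 N w).
  by rewrite ge_min f1.
have fin := unit_interval_expectation_fin P (discount_at_jump_measurable m)
  (discount_at_jump_bound m).
have cvG := unit_interval_expectation_cvg (P := P) mG
  (discount_at_jump_measurable m) G01 (discount_at_jump_bound m).
have {}cvG : fine ('E_P[G N])%E @[N --> \oo] -->
    fine ('E_P[discount_at_jump m])%E.
  apply: cvG => w; apply: cvg_near_cst.
  by have := discount_le_hit m w; apply: filterS => N /min_idPl.
rewrite -(fineK fin) lee_fin.
have c1 : c N * beta ^+ m @[N --> \oo] --> beta ^+ m.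
  rewrite -[X in _ --> X]mul1r; apply: cvgMl.
  rewrite -expR0; apply: continuous_cvg; first exact: continuous_expR.
  rewrite -(mulr0 z); apply: cvgMr.
  apply/cvgrPdist_lt => e e0; have := grid_mesh_lt t e0; apply: filterS => N.
  by rewrite sub0r normrN ger0_norm// divr_ge0// ltW.
apply: (ler_cvg_to cvG c1); apply: nearW => N.
rewrite -lee_fin fineK; last exact: unit_interval_expectation_fin.
apply: (@le_trans _ _ ((c N)%:E * 'E_P[hit N m])%E).
  rewrite !unlock -ge0_integralZl//.
  - apply: ge0_le_integral => //.
    + by move=> w _; rewrite lee_fin; case/andP: (G01 N w).
    + exact/measurable_EFinP.
    + by apply/measurable_EFinP; exact: measurable_funM.
    + by move=> w _; rewrite -EFinM lee_fin ge_min lexx orbT.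
  - exact/measurable_EFinP.
  - by move=> w _; rewrite lee_fin; case/andP: (hit0 N w).
  - by rewrite lee_fin expR_ge0.
rewrite EFinM; apply: lee_wpmul2l; last exact: hit_expectation.
by rewrite lee_fin expR_ge0.
Qed.

End jump_time_discount.

(** * The error term *)

Section error_term.
Context {R : realType}.

(** When x = lbar T / (m - 1) < 1 the tilt q makes lbar / (lbar + 2 q) equal to
x; then exp (2 q T) * x ^ m = x * (x * exp (1 - x)) ^ (m - 1), and
x <= exp (x - 1).  When x >= 1 the choice is q = 0. *)
Lemma exponential_tilt (lbar rho T : R) (m : nat) :
  0 < lbar -> 0 <= rho -> 0 < T -> (1 < m)%N ->
  exists2 q, 0 <= q &
  expR (q * T) * (lbar / (lbar + (rho + q))) ^+ m <=
  (lbar * T / (m%:R - 1)) `^ 2^-1 * (lbar / (2 * rho + lbar)) `^ (m%:R / 2).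
Proof.
move=> l0 rho0 T0; case: m => // k; rewrite ltnS => k0.
have kR : 0 < k%:R :> R by rewrite ltr0n.
have -> : k.+1%:R - 1 = k%:R :> R by rewrite -natr1 addrK.
set x := lbar * T / k%:R; have x0 : 0 < x by rewrite divr_gt0// mulr_gt0.
have lr0 : 0 < 2 * rho + lbar by rewrite ltr_wpDl// mulr_ge0.
set y := lbar / (2 * rho + lbar); have y0 : 0 < y by rewrite divr_gt0.
(* Since (lbar + rho + q) ^ 2 >= (lbar + 2 rho) (lbar + 2 q), the square of the
   left-hand side splits into a factor in rho and a factor in q. *)
suff [q q0 Hq] : exists2 q, 0 <= q &
    expR (2 * q * T) * (lbar / (lbar + 2 * q)) ^+ k.+1 <= x.
  exists q => //.
  have lq0 : 0 < lbar + 2 * q by rewrite ltr_wpDr// mulr_ge0.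
  have lrq0 : 0 < lbar + (rho + q) by rewrite ltr_wpDr// addr_ge0.
  rewrite powRrM powR_mulrn ?(ltW y0)// -powRM ?(ltW x0) ?exprn_ge0 ?(ltW y0)//.
  rewrite powR12_sqrt; last by rewrite mulr_ge0 ?(ltW x0)// exprn_ge0// ltW.
  set lhs := expR _ * _.
  apply: (@le_trans _ _ (Num.sqrt (lhs ^+ 2))); first by rewrite sqrtr_sqr ler_norm.
  apply: ler_wsqrtr.
  have -> : lhs ^+ 2 = expR (2 * q * T) * ((lbar / (lbar + (rho + q))) ^+ 2) ^+ k.+1.
    rewrite /lhs exprMn exprAC; congr (_ * _).
    by rewrite expr2 -expRD; congr expR; ring.
  have sq : (lbar / (lbar + (rho + q))) ^+ 2 <= lbar / (lbar + 2 * q) * y.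
    rewrite expr_div_n /y mulf_div -expr2 ler_wpM2l ?sqr_ge0//.
    rewrite lef_pV2 ?posrE ?mulr_gt0 ?exprn_gt0//.
    by have := sqr_ge0 (rho - q); rewrite !expr2; lra.
  apply: (@le_trans _ _ (expR (2 * q * T) * (lbar / (lbar + 2 * q) * y) ^+ k.+1)).
    rewrite ler_wpM2l ?expR_ge0// lerXn2r// nnegrE ?sqr_ge0//.
    by rewrite mulr_ge0 ?(ltW y0)// divr_ge0 ?ltW.
  by rewrite exprMn mulrA ler_wpM2r// exprn_ge0// ltW.
have [x1|x1] := leP 1 x.
  exists 0; first by [].
  by rewrite mulr0 mul0r expR0 mul1r addr0 divff ?gt_eqF// expr1n.
exists ((k%:R / T - lbar) / 2).
  rewrite divr_ge0// subr_ge0 ler_pdivlMr//.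
  by move: x1; rewrite /x ltr_pdivrMr// mul1r => /ltW.
have -> : lbar + 2 * ((k%:R / T - lbar) / 2) = k%:R / T by field; rewrite gt_eqF.
have -> : lbar / (k%:R / T) = x by rewrite /x; field; rewrite !gt_eqF.
have -> : 2 * ((k%:R / T - lbar) / 2) * T = k%:R * (1 - x).
  by rewrite /x; field; rewrite !gt_eqF.
rewrite mulrC expRM_natl exprS -mulrA -exprMn ler_piMr ?(ltW x0)//.
apply: exprn_ile1; first by rewrite mulr_ge0 ?expR_ge0 ?(ltW x0).
have := expR_ge1Dx (x - 1); rewrite addrC subrK -[x - 1]opprB expRN.
by move=> h; rewrite -ler_pdivlMr ?expR_gt0// div1r.
Qed.

End error_term.

(** * Rewards and payoffs *)

Section rewards_on_simplex.
Context {R : realType} {n : nat}.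

Lemma simplex_coord (v : 'rV[R]_n) i : simplex n v -> 0 <= v ord0 i <= 1.
Proof.
move=> [v0 v1]; rewrite v0/= -v1 (bigD1 i)//= lerDl.
by apply: sumr_ge0.
Qed.

Lemma linear_reward_bound (c : 'I_n -> R) (v : 'rV[R]_n) :
  simplex n v -> `|linear_reward c v| <= \sum_i `|c i|.
Proof.
move=> sv; apply: (le_trans (ler_norm_sum _ _ _)); apply: ler_sum => i _.
rewrite normrM ler_piMr//; have /andP[v0 v1] := simplex_coord i sv.
by rewrite ger0_norm.
Qed.

Lemma simplex_norm_ge (g : 'rV[R]_n -> R) (K : R) (v : 'rV[R]_n) :
  (forall u, simplex n u -> `|g u| <= K) -> simplex n v ->
  `|g v| <= simplex_norm g.
Proof.
move=> gK sv; apply: ub_le_sup; last by exists v.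
by exists K => _ [u su <-]; exact: gK.
Qed.

Lemma linear_reward_norm (c : 'I_n -> R) (v : 'rV[R]_n) :
  simplex n v -> `|linear_reward c v| <= simplex_norm (linear_reward c).
Proof. exact/simplex_norm_ge/linear_reward_bound. Qed.

Lemma simplex_vertex i : simplex n (delta_mx ord0 i : 'rV[R]_n).
Proof.
split=> [j|]; first by rewrite mxE.
rewrite (bigD1 i)//= big1 ?addr0; first by rewrite mxE !eqxx.
by move=> j /negPf ji; rewrite mxE ji andbF.
Qed.

Lemma linear_reward_norm_ge0 (c : 'I_n -> R) : (0 < n)%N ->
  0 <= simplex_norm (linear_reward c).
Proof.
move=> n0; apply: le_trans (normr_ge0 _) _.
exact: linear_reward_norm (simplex_vertex (Ordinal n0)).
Qed.

Variables (a : nat) (mu : 'I_a -> 'I_n -> R).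
Hypothesis a_gt0 : (0 < a)%N.

Let B := \sum_k \sum_i `|mu k i|.

Let linear_le k v : simplex n v -> `|linear_reward (mu k) v| <= B.
Proof.
move=> sv; apply: (le_trans (linear_reward_bound _ sv)).
by rewrite /B (bigD1 k)//= lerDl; apply: sumr_ge0 => j _; exact: sumr_ge0.
Qed.

Let terminal_has_sup v : has_sup [set linear_reward (mu k) v | k in [set: 'I_a]].
Proof.
split; first by exists (linear_reward (mu (Ordinal a_gt0)) v), (Ordinal a_gt0).
exists (\sum_k `|linear_reward (mu k) v|) => _ [k _ <-].
rewrite (bigD1 k)//=; apply: (le_trans (ler_norm _)); rewrite lerDl.
exact: sumr_ge0.
Qed.

Lemma terminal_reward_norm (v : 'rV[R]_n) :
  simplex n v -> `|terminal_reward mu v| <= simplex_norm (terminal_reward mu).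
Proof.
apply: (@simplex_norm_ge _ B) => u su; have hs := terminal_has_sup u.
rewrite ler_norml; apply/andP; split.
  apply: (@le_trans _ _ (linear_reward (mu (Ordinal a_gt0)) u)).
    by have := linear_le (Ordinal a_gt0) su; rewrite ler_norml => /andP[].
  by apply: ub_le_sup; [case: hs|exists (Ordinal a_gt0)].
apply: ge_sup; first by case: hs.
by move=> _ [k _ <-]; apply: (le_trans (ler_norm _)); exact: linear_le.
Qed.

Lemma terminal_reward_norm_ge0 : (0 < n)%N ->
  0 <= simplex_norm (terminal_reward mu).
Proof.
move=> n0; apply: le_trans (normr_ge0 _) _.
exact: terminal_reward_norm (simplex_vertex (Ordinal n0)).
Qed.

Context {d : measure_display} {Omega : measurableType d}.
Implicit Types Z : Omega -> 'rV[R]_n.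

Lemma linear_reward_measurable (c : 'I_n -> R) Z :
  (forall i, measurable_fun [set: Omega] (fun w => Z w ord0 i)) ->
  measurable_fun [set: Omega] (fun w => linear_reward c (Z w)).
Proof. by move=> mZ; apply: measurable_sum => i; exact: measurable_funM. Qed.

(** A supremum of finitely many linear rewards exceeds x when one of them
does. *)
Lemma terminal_reward_measurable Z :
  (forall i, measurable_fun [set: Omega] (fun w => Z w ord0 i)) ->
  measurable_fun [set: Omega] (fun w => terminal_reward mu (Z w)).
Proof.
move=> mZ; apply: (measurability _ (RGenOInfty.measurableE R)).
move=> _ [_ [x ->] <-]; rewrite setTI.
rewrite (_ : _ @^-1` _ = \bigcup_(k in [set: 'I_a])
    ((fun w => linear_reward (mu k) (Z w)) @^-1` `]x, +oo[)).
  apply: fin_bigcup_measurable => [|k _]; first exact: finite_finset.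
  rewrite -[X in measurable X]setTI.
  by apply: linear_reward_measurable.
apply/seteqP; split=> w /=; rewrite in_itv/= andbT.
  move=> /(sup_gt (terminal_has_sup _).1)[_ [k _ <-] xk].
  by exists k => //=; rewrite in_itv/= xk.
move=> [k _ /=]; rewrite in_itv/= andbT => /lt_le_trans; apply.
by apply: ub_le_sup; [case: (terminal_has_sup (Z w))|exists k].
Qed.

End rewards_on_simplex.

Section payoffs.
Context {R : realType} {d : measure_display} {Omega : measurableType d}.
Context {n a : nat}.
Variables (c : 'I_n -> R) (mu : 'I_a -> 'I_n -> R) (rho T : R).
Hypothesis a_gt0 : (0 < a)%N.
Hypothesis rho_ge0 : 0 <= rho.
Variable Z : R -> Omega -> 'rV[R]_n.
Hypothesis Z_simplex : forall t w, 0 <= t -> simplex n (Z t w).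
Hypothesis Z_meas : forall t i, 0 <= t ->
  measurable_fun [set: Omega] (fun w => Z t w ord0 i).
Hypothesis Z_right : forall i w t, 0 <= t ->
  Z u w ord0 i @[u --> t^'+] --> Z t w ord0 i.

Local Notation C := (linear_reward c).
Local Notation H := (terminal_reward mu).
Local Notation normC := (simplex_norm C).
Local Notation normH := (simplex_norm H).

Let Z_joint i : measurable_fun [set: R * Omega]
  (fun z => Z (Num.max z.1 0) z.2 ord0 i).
Proof.
apply: (right_continuous_measurable (Z := fun t w => Z t w ord0 i)).
  by move=> u; exact: Z_meas.
by move=> w t; exact: Z_right.
Qed.

Let running (z : R * Omega) := expR (- rho * z.1) * C (Z (Num.max z.1 0) z.2).

Let running_measurable : measurable_fun [set: R * Omega] running.
Proof.
apply: measurable_funM.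
  apply: measurableT_comp => //; apply: measurable_funM => //.
by apply: (@linear_reward_measurable R n _ _ c (fun z : R * Omega => Z (Num.max z.1 0) z.2)).
Qed.

Let runningE t w : \int[lebesgue_measure]_(s in `[0, t]) (expR (- rho * s) * C (Z s w))
  = \int[lebesgue_measure]_(s in `[0, t]) running (s, w).
Proof.
apply: eq_Rintegral => s; rewrite inE/= in_itv/= => /andP[s0 _].
by rewrite /running/= (max_idPl s0).
Qed.

Let running_le x t w : 0 <= x -> x <= t ->
  `|running (t, w)| <= expR (- rho * x) * normC.
Proof.
move=> x0 xt; rewrite /running/= normrM ger0_norm ?expR_ge0// ler_pM ?expR_ge0//.
  by rewrite ler_expR !mulNr lerN2 ler_wpM2l.
apply: linear_reward_norm; apply: Z_simplex.
by rewrite le_max lexx orbT.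
Qed.

Let integral_running_incr x t w : 0 <= x -> x <= t ->
  `| \int[lebesgue_measure]_(s in `[0, t]) (expR (- rho * s) * C (Z s w))
    - \int[lebesgue_measure]_(s in `[0, x]) (expR (- rho * s) * C (Z s w)) |
  <= expR (- rho * x) * normC * (t - x).
Proof.
move=> x0 xt; rewrite !runningE.
apply: (@Rintegral_increment _ (fun s => running (s, w)) x t _
    (expR (- rho * 0) * normC)) => //.
- by apply: measurable_funTS; exact: measurable_fun_pair1 running_measurable.
- by move=> s /andP[s0 _]; exact: running_le.
- by move=> s /andP[xs _]; exact: running_le.
Qed.

Let terminal_le x t w : 0 <= x -> x <= t ->
  `|expR (- rho * t) * H (Z t w)| <= expR (- rho * x) * normH.
Proof.
move=> x0 xt; rewrite normrM ger0_norm ?expR_ge0// ler_pM ?expR_ge0//.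
  by rewrite ler_expR !mulNr lerN2 ler_wpM2l.
by apply: terminal_reward_norm => //; apply: Z_simplex; exact: le_trans xt.
Qed.

(** A point w of Omega provides the element Z 0 w of the simplex. *)
Let normC_ge0 : Omega -> 0 <= normC.
Proof.
move=> w; apply: (le_trans (normr_ge0 (C (Z 0 w)))).
by apply: linear_reward_norm; exact: Z_simplex.
Qed.

Lemma payoff_bound (theta : Omega -> R) w : 0 <= theta w <= T ->
  `|payoff rho C H Z theta w| <= T * normC + normH.
Proof.
move=> /andP[t0 tT]; apply: (le_trans (ler_normD _ _)); apply: lerD.
  have := integral_running_incr w (lexx 0) t0.
  rewrite set_itv1 Rintegral_set1 !subr0 mulr0 expR0 mul1r => /le_trans; apply.
  by rewrite mulrC ler_wpM2r// normC_ge0.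
by have := terminal_le w (lexx 0) t0; rewrite mulr0 expR0 mul1r.
Qed.

(** Continuing from x to a later time t changes the running part by at most
normC * (t - x) and the terminal part by at most 2 * normH, discounted at x. *)
Lemma payoff_diff (theta theta' : Omega -> R) w : 0 <= theta' w -> theta' w <= theta w ->
  theta w <= T ->
  payoff rho C H Z theta w <= payoff rho C H Z theta' w +
    (T * normC + 2 * normH) * expR (- (rho * theta' w)).
Proof.
rewrite /payoff; move: (theta w) (theta' w) => t x x0 xt tT.
have := integral_running_incr w x0 xt; rewrite ler_norml => /andP[_ h1].
have := terminal_le w x0 xt; rewrite ler_norml => /andP[_ h2].
have := terminal_le w x0 (lexx x); rewrite ler_norml => /andP[h3 _].
have h4 : expR (- rho * x) * normC * (t - x) <= expR (- rho * x) * normC * T.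
  rewrite ler_wpM2l//; last by lra.
  by rewrite mulr_ge0 ?expR_ge0// normC_ge0.
rewrite -mulNr; move: h1 h2 h3 h4; set E := expR (- rho * x) => h1 h2 h3 h4.
have -> : (T * normC + 2 * normH) * E =
  E * normC * T + (E * normH + E * normH) by ring.
lra.
Qed.

Lemma payoff_measurable (theta : Omega -> R) : measurable_fun [set: Omega] theta ->
  (forall w, 0 <= theta w) ->
  measurable_fun [set: Omega] (payoff rho C H Z theta).
Proof.
move=> mtheta theta0; apply: measurable_funD.
  under eq_fun do rewrite runningE.
  exact: measurable_integral_random_time.
apply: measurable_funM.
  by apply: measurableT_comp => //; exact: measurable_funM.
apply: terminal_reward_measurable => // i.
rewrite (_ : (fun w => _) = (fun z : R * Omega => Z (Num.max z.1 0) z.2 ord0 i) \o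
  (fun w : Omega => (theta w, w))).
  by apply: measurableT_comp => //; exact: measurable_fun_pair.
by apply/funext => w /=; rewrite (max_idPl (theta0 w)).
Qed.

End payoffs.

(** * The filter process *)

Section filter_process.
Context {R : realType} {d : measure_display} {Omega : measurableType d}.
Context {n p : nat}.
Variables (P : probability Omega R) (Q : 'M[R]_n) (lambda : 'I_n -> R).
Variables (nu : 'I_n -> probability (borelRV R p) R) (pi : 'rV[R]_n).
Variables (M : R -> Omega -> 'I_n) (Xi : 'I_n -> R -> Omega -> 'rV[R]_p).
Variable x0 : 'rV[R]_p.
Hypothesis lambda_gt0 : forall i, 0 < lambda i.
Hypothesis model : hidden_markov_model P Q lambda nu pi M Xi.
Local Notation X := (observation x0 M Xi).

Variables (Pr : 'rV[R]_n -> probability Omega R) (f : 'I_n -> borelRV R p -> R).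
Variable Z : R -> Omega -> 'rV[R]_n.
Hypothesis dynamics : filter_dynamics (flow Pr lambda M) lambda f X pi Z.

Let lambda_ge0 i : 0 <= lambda i. Proof. exact: ltW. Qed.

Let M_meas t i : 0 <= t -> measurable (M t @^-1` [set i]).
Proof. exact: (hidden_measurable model). Qed.

Let M_right w t : 0 <= t -> \forall u \near t^'+, M u w = M t w.
Proof. exact: (hidden_step_path model w).1. Qed.

(** Every time lies between two consecutive jump times, as the observation has
finitely many jumps on bounded intervals. *)
Let between_jumps t w : 0 <= t -> exists k s,
  [/\ jump_time X k w = s%:E, 0 <= s <= t, (t%:E < jump_time X k.+1 w)%E &
      forall u, s <= u -> (u%:E < jump_time X k.+1 w)%E ->
        Z u w = flow Pr lambda M (u - s) (Z s w)].
Proof.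
move=> t0; have [k /andP[kt tk]] :=
  @observation_jump_count R d Omega n p x0 M Xi (joint_step_path model) t w t0.
have k0 := jump_time_ge0 X w k.
have kfin : jump_time X k w = (fine (jump_time X k w))%:E.
  by rewrite fineK// ge0_fin_numE// (le_lt_trans kt)// ltry.
exists k, (fine (jump_time X k w)); split=> //.
  by rewrite -!lee_fin -kfin k0.
move=> u su uk; have [_ /(_ k u) + _] := dynamics w.
by apply; rewrite uk andbT kfin lee_fin.
Qed.

(** The flow takes values in the simplex whatever its starting point.  At a jump
time s too, Z s is a value of the flow, namely that at time 0 from Z s. *)
Lemma filter_simplex t w : 0 <= t -> simplex n (Z t w).
Proof.
move=> t0; have [k [s [_ /andP[s0 st] tk ->//]]] := between_jumps w t0.
apply: (flow_law_simplex lambda_ge0 M_meas M_right (Pr (Z s w))).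
by rewrite subr_ge0.
Qed.

Lemma filter_right_continuous i w t : 0 <= t ->
  Z u w ord0 i @[u --> t^'+] --> Z t w ord0 i.
Proof.
move=> t0; have [k [s [_ /andP[s0 st] tk H]]] := between_jumps w t0.
rewrite H//; apply/cvg_at_rightP => u [tu ut].
have ts0 : 0 <= t - s by rewrite subr_ge0.
have cv : flow Pr lambda M u (Z s w) ord0 i @[u --> (t - s)^'+] -->
    flow Pr lambda M (t - s) (Z s w) ord0 i.
  exact: (flow_law_right_continuous lambda_ge0 M_meas M_right).
have {}cv : flow Pr lambda M (u j - s) (Z s w) ord0 i @[j --> \oo] -->
    flow Pr lambda M (t - s) (Z s w) ord0 i.
  move/cvg_at_rightP : cv => /(_ (fun j => u j - s)); apply.
  split; first by move=> j; rewrite ltrD2r.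
  by apply: cvgB => //; exact: cvg_cst.
have tk' : \forall j \near \oo, ((u j)%:E < jump_time X k.+1 w)%E.
  case E : (jump_time X k.+1 w) tk => [x| |] //= tk; last first.
    by apply: nearW => j; rewrite ltry.
  rewrite lte_fin in tk.
  have e0 : 0 < x - t by rewrite subr_gt0.
  move/cvgrPdist_lt : ut => /(_ _ e0); apply: filterS => j.
  rewrite ltr0_norm ?subr_lt0// opprB lte_fin.
  by rewrite ltrD2r.
apply: cvg_trans cv; apply: near_eq_cvg; move: tk'; apply: filterS => j uk.
by rewrite (H (u j) (le_trans st (ltW (tu j))) uk).
Qed.

Hypothesis Z_cond : conditional_probability P (observation_filtration X) M Z.

Let filtration_measurable t A : 0 <= t -> observation_filtration X t A -> measurable A.
Proof.
apply: (observation_filtration_measurable (joint_step_path model)).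
- by move=> u i; exact: M_meas.
- by move=> i u B; exact: (source_measurable model).
Qed.

Lemma filter_measurable t i : 0 <= t ->
  measurable_fun [set: Omega] (fun w => Z t w ord0 i).
Proof.
move=> t0 _ B mB; rewrite setTI.
by apply: (filtration_measurable t0); exact: (Z_cond i t0).1.
Qed.

Lemma stopping_time_measurable s tau :
  stopping_times (observation_filtration X) s tau ->
  measurable_fun [set: Omega] tau.
Proof.
move=> [tau_s stop]; apply/measurable_EFinP; apply: measurable_ereal_rv => /=.
  by move=> w; rewrite lee_fin; case/andP: (tau_s w).
move=> t t0; apply: (filtration_measurable t0).
rewrite (_ : [set w | _] = [set w | tau w <= t]); first exact: stop.
by apply/seteqP; split=> w /=; rewrite lee_fin.
Qed.

Lemma stopping_time_min_jump s m tau :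
  stopping_times (observation_filtration X) s tau ->
  stopping_times (observation_filtration X) s
    (fun w => fine (mine (tau w)%:E (jump_time X m w))).
Proof.
move=> [tau_s stop].
have minE w : (fine (mine (tau w)%:E (jump_time X m w)))%:E =
    mine (tau w)%:E (jump_time X m w).
  rewrite fineK// ge0_fin_numE.
    by rewrite gt_min ltry.
  by rewrite le_min lee_fin jump_time_ge0 andbT; case/andP: (tau_s w).
split.
  move=> w; have /andP[t0 ts] := tau_s w; rewrite -!lee_fin minE.
  by rewrite le_min lee_fin t0 jump_time_ge0/= ge_min lee_fin ts.
move=> t t0; rewrite (_ : [set w | _] =
  [set w | tau w <= t] `|` [set w | (jump_time X m w <= t%:E)%E]); last first.
  have E w : (fine (mine (tau w)%:E (jump_time X m w)) <= t) =
      (tau w <= t) || (jump_time X m w <= t%:E)%E.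
    by rewrite -lee_fin minE ge_min lee_fin.
  apply/seteqP; split=> w; rewrite /mkset E; first by move=> /orP[]; [left|right].
  by move=> [->//|]; rewrite /mkset => ->; rewrite orbT.
apply: (@measurableU _ (g_sigma_algebraType _)); first exact: stop.
exact: (jump_time_stopping (joint_step_path model)).
Qed.

End filter_process.

(** * Value functions *)

Section bounded_expectations.
Context {R : realType} {d : measure_display} {Omega : measurableType d}.
Variable P : probability Omega R.

Lemma bounded_integrable (f : Omega -> R) K : measurable_fun setT f ->
  (forall w, `|f w| <= K) -> P.-integrable setT (EFin \o f).
Proof.
move=> mf fK; apply: measurable_bounded_integrable => //.
  by rewrite -ge0_fin_numE// fin_num_measure.
exists K; split; first exact: num_real.
by move=> x Kx w _ /=; rewrite (le_trans (fK w))// ltW.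
Qed.

Lemma bounded_expectation (f : Omega -> R) K : measurable_fun setT f ->
  (forall w, `|f w| <= K) -> ((- K)%:E <= 'E_P[f] <= K%:E)%E.
Proof.
move=> mf fK; have intf := bounded_integrable mf fK.
have cstE (x : R) : (\int[P]_w (cst x w)%:E = x%:E)%E.
  have := expectation_cst P x; by rewrite unlock.
rewrite unlock -(cstE (- K)) -(cstE K); apply/andP; split.
  apply: le_integral => //; first exact: finite_measure_integrable_cst.
  by move=> w _; rewrite lee_fin; have := fK w; rewrite ler_norml => /andP[].
apply: le_integral => //; first exact: finite_measure_integrable_cst.
by move=> w _; rewrite lee_fin; have := fK w; rewrite ler_norml => /andP[].
Qed.

Lemma expectation_leD (f g h : Omega -> R) K (k : R) :
  measurable_fun setT f -> measurable_fun setT g -> measurable_fun setT h ->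
  (forall w, `|f w| <= K) -> (forall w, `|g w| <= K) -> (forall w, 0 <= h w <= 1) ->
  (forall w, f w <= g w + k * h w) -> ('E_P[f] <= 'E_P[g] + k%:E * 'E_P[h])%E.
Proof.
move=> mf mg mh fK gK h01 fgh.
have intg := bounded_integrable mg gK.
have inth := unit_interval_integrable P mh h01.
have intkh : P.-integrable setT (fun w => (k%:E * (h w)%:E)%E) by exact: integrableZl.
rewrite !unlock -integralZl// -integralD//.
apply: le_integral => //; first exact: bounded_integrable fK.
  exact: integrableD.
by move=> w _; rewrite -EFinM -EFinD lee_fin.
Qed.

Lemma ereal_sup_bounded_fin_num (A : set (\bar R)) K : A !=set0 ->
  (forall x, A x -> ((- K)%:E <= x <= K%:E)%E) -> ereal_sup A \is a fin_num.
Proof.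
move=> [x Ax] AK; rewrite fin_numElt; apply/andP; split.
  have /andP[xK _] := AK _ Ax.
  by rewrite (lt_le_trans (ltNyr (- K)))// (le_trans xK)// ereal_sup_ubound.
apply: (@le_lt_trans _ _ K%:E); last exact: ltry.
by apply: ge_ereal_sup => y /AK /andP[].
Qed.

End bounded_expectations.

Section value_functions.
Context {R : realType} {d : measure_display} {Omega : measurableType d}.
Context {n p a : nat}.
Variables (P : probability Omega R) (Q : 'M[R]_n) (lambda : 'I_n -> R).
Variables (nu : 'I_n -> probability (borelRV R p) R) (pi : 'rV[R]_n).
Variables (M : R -> Omega -> 'I_n) (Xi : 'I_n -> R -> Omega -> 'rV[R]_p).
Variable x0 : 'rV[R]_p.
Variables (c : 'I_n -> R) (mu : 'I_a -> 'I_n -> R) (rho T : R).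
Hypothesis n_gt0 : (0 < n)%N.
Hypothesis a_gt0 : (0 < a)%N.
Hypothesis rho_ge0 : 0 <= rho.
Hypothesis T_gt0 : 0 < T.
Hypothesis lambda_gt0 : forall i, 0 < lambda i.
Hypothesis model : hidden_markov_model P Q lambda nu pi M Xi.
Local Notation X := (observation x0 M Xi).

Variables (Pr : 'rV[R]_n -> probability Omega R) (f : 'I_n -> borelRV R p -> R).
Variable Z : R -> Omega -> 'rV[R]_n.
Hypothesis dynamics : filter_dynamics (flow Pr lambda M) lambda f X pi Z.
Hypothesis Z_cond : conditional_probability P (observation_filtration X) M Z.

Local Notation C := (linear_reward c).
Local Notation H := (terminal_reward mu).
Local Notation lbar := (max_rate lambda).
Let K := T * simplex_norm C + simplex_norm H.
Let K2 := T * simplex_norm C + 2 * simplex_norm H.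

Lemma max_rate_ge i : lambda i <= lbar.
Proof.
apply: ub_le_sup; last by exists i.
exists (\sum_j lambda j) => _ [j _ <-]; rewrite (bigD1 j)//= lerDl.
by apply: sumr_ge0 => k _; exact: ltW.
Qed.

Lemma max_rate_gt0 : 0 < lbar.
Proof. exact: lt_le_trans (lambda_gt0 (Ordinal n_gt0)) (max_rate_ge _). Qed.

Let Z_simplex t w : 0 <= t -> simplex n (Z t w).
Proof. exact: (filter_simplex lambda_gt0 model dynamics). Qed.

Let Z_meas t i : 0 <= t -> measurable_fun [set: Omega] (fun w => Z t w ord0 i).
Proof. exact: (filter_measurable model Z_cond). Qed.

Let Z_right i w t : 0 <= t -> Z u w ord0 i @[u --> t^'+] --> Z t w ord0 i.
Proof. exact: (filter_right_continuous lambda_gt0 model dynamics). Qed.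

Let K2_ge0 : 0 <= K2.
Proof.
by rewrite addr_ge0 ?mulr_ge0 ?(ltW T_gt0) ?linear_reward_norm_ge0
  ?terminal_reward_norm_ge0.
Qed.

Local Notation stopping := (stopping_times (observation_filtration X)).
Local Notation gain := (payoff rho C H Z).

Section fixed_horizon.
Variable s : R.
Hypothesis sT : 0 <= s <= T.

Let stopping_le tau w : stopping s tau -> 0 <= tau w <= T.
Proof.
move=> [/(_ w)/andP[-> ts] _] /=; apply: (le_trans ts).
by case/andP: sT.
Qed.

Let gain_measurable tau : stopping s tau -> measurable_fun [set: Omega] (gain tau).
Proof.
move=> st; apply: (payoff_measurable c mu rho a_gt0 Z_meas Z_right).
  exact: (stopping_time_measurable model st).
by move=> w; case/andP: (stopping_le w st).
Qed.

Let gain_bound tau w : stopping s tau -> `|gain tau w| <= K.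
Proof.
move=> st; apply: (payoff_bound c mu a_gt0 rho_ge0 Z_simplex Z_meas Z_right).
exact: stopping_le.
Qed.

Let stopping0 : stopping s (fun=> 0).
Proof.
split; first by move=> w; rewrite lexx; case/andP: sT.
move=> t t0; rewrite (_ : [set w | _] = setT).
  exact: (@measurableT _ (g_sigma_algebraType _)).
by apply/seteqP; split.
Qed.

Let gain_expectation tau : stopping s tau ->
  ((- K)%:E <= 'E_P[gain tau] <= K%:E)%E.
Proof.
by move=> st; apply: bounded_expectation => [|w]; [exact: gain_measurable|exact: gain_bound].
Qed.

Local Notation capped m tau := (fun w => fine (mine (tau w)%:E (jump_time X m w))).

Let stopping_capped m tau : stopping s tau -> stopping s (capped m tau).
Proof. exact: (stopping_time_min_jump model). Qed.

Lemma value_fin_num : value rho C H P X Z s \is a fin_num.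
Proof.
apply: (@ereal_sup_bounded_fin_num _ _ K); first by exists 'E_P[gain (fun=> 0%R)]%E, (fun=> 0).
by move=> _ [tau st <-]; exact: gain_expectation.
Qed.

Lemma value_jumps_fin_num m : value_jumps rho C H P X Z m s \is a fin_num.
Proof.
apply: (@ereal_sup_bounded_fin_num _ _ K).
  by exists 'E_P[gain (capped m (fun=> 0%R))]%E, (fun=> 0).
by move=> _ [tau st <-]; apply: gain_expectation; exact: stopping_capped.
Qed.

Lemma value_jumps_le m : (value_jumps rho C H P X Z m s <= value rho C H P X Z s)%E.
Proof.
apply: ereal_sup_le => _ [tau st <-]; exists (capped m tau) => //.
exact: stopping_capped.
Qed.

(** Capping changes the payoff only if sigma_m < tau, and tau <= T, so that the
discount at the m-th jump is then not cut off. *)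
Let gain_le_capped m tau w : stopping s tau ->
  gain tau w <= gain (capped m tau) w + K2 * discount_at_jump M Xi x0 T rho m w.
Proof.
move=> st; have /andP[t0 tT] := stopping_le w st.
have D0 : 0 <= discount_at_jump M Xi x0 T rho m w.
  by case/andP: (discount_at_jump_bound M Xi x0 T rho_ge0 m w).
have [ts|ts] := leP (tau w)%:E (jump_time X m w).
  rewrite {2}/payoff (min_idPl ts)/= -/(gain tau w).
  by rewrite lerDl mulr_ge0.
have mfin : jump_time X m w = (fine (jump_time X m w))%:E.
  by rewrite fineK// ge0_fin_numE ?(lt_trans ts) ?ltry// jump_time_ge0.
have capE : capped m tau w = fine (jump_time X m w) by rewrite (min_idPr (ltW ts)).
have -> : discount_at_jump M Xi x0 T rho m w = expR (- (rho * capped m tau w)).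
  by rewrite capE /discount_at_jump (le_trans (ltW ts)) ?lee_fin.
apply: (payoff_diff c mu a_gt0 rho_ge0 Z_simplex Z_meas Z_right) => //.
  by case/andP: (stopping_le w (stopping_capped m st)).
by rewrite capE -lee_fin -mfin ltW.
Qed.

Let discount_bound m : (1 < m)%N ->
  ('E_P[discount_at_jump M Xi x0 T rho m] <=
   ((lbar * T / (m%:R - 1)) `^ 2^-1 * (lbar / (2 * rho + lbar)) `^ (m%:R / 2))%:E)%E.
Proof.
move=> m1; have [q q0 Hq] := exponential_tilt max_rate_gt0 rho_ge0 T_gt0 m1.
have rq0 : 0 <= rho + q by exact: addr_ge0.
apply: (@le_trans _ _
    (expR (q * T) * (lbar / (lbar + (rho + q))) ^+ m)%:E); last by rewrite lee_fin.
rewrite EFinM; apply: (@le_trans _ _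
    ((expR (q * T))%:E * 'E_P[discount_at_jump M Xi x0 T (rho + q) m])%E); last first.
  apply: lee_wpmul2l; first by rewrite lee_fin expR_ge0.
  exact: (expectation_discount_at_jump x0 lambda_gt0 model max_rate_ge max_rate_gt0
    T_gt0 rq0 m).
have mD z : measurable_fun setT (discount_at_jump M Xi x0 T z m).
  exact: (discount_at_jump_measurable x0 model z T_gt0).
rewrite !unlock -ge0_integralZl//.
- apply: ge0_le_integral => //.
  + by move=> w _; rewrite lee_fin; case/andP: (discount_at_jump_bound M Xi x0 T rho_ge0 m w).
  + exact/measurable_EFinP.
  + by apply/measurable_EFinP; exact: measurable_funM.
  + move=> w _; rewrite -EFinM lee_fin /discount_at_jump.
    case: ifPn => [mT|_]; last by rewrite mulr0.
    have m0 := jump_time_ge0 X w m.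
    have mfin : jump_time X m w = (fine (jump_time X m w))%:E.
      by rewrite fineK// ge0_fin_numE// (le_lt_trans mT)// ltry.
    rewrite -expRD ler_expR; move: mT; rewrite mfin lee_fin.
    move: (fine _) => x xT; rewrite mulrDl opprD addrCA lerDl -mulrBr.
    by rewrite mulr_ge0// subr_ge0.
- exact/measurable_EFinP.
- by move=> w _; rewrite lee_fin; case/andP: (discount_at_jump_bound M Xi x0 T rq0 m w).
Qed.

Lemma value_le_value_jumps m : (0 < m)%N ->
  (value rho C H P X Z s <= value_jumps rho C H P X Z m s +
    error_bound T rho (simplex_norm C) (simplex_norm H) lbar m)%E.
Proof.
move=> m0; rewrite /error_bound; case: eqP => [_|m1].
  rewrite addey ?leey//; apply: contraTneq (value_jumps_fin_num m) => ->.
  by rewrite fin_numElt ltxx.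
have {m0 m1} m1 : (1 < m)%N by case: m m0 m1 => [|[|]].
apply: ge_ereal_sup => _ [tau st <-].
apply: (@le_trans _ _ ('E_P[gain (capped m tau)] +
    K2%:E * 'E_P[discount_at_jump M Xi x0 T rho m])%E).
  apply: (@expectation_leD _ _ _ _ _ _ _ K).
  - exact: gain_measurable.
  - exact/gain_measurable/stopping_capped.
  - exact: (discount_at_jump_measurable x0 model rho T_gt0).
  - by move=> w; exact: gain_bound.
  - by move=> w; apply: gain_bound; exact: stopping_capped.
  - by move=> w; exact: discount_at_jump_bound.
  - by move=> w; exact: gain_le_capped.
apply: leeD; first by apply: ereal_sup_ubound; exists tau.
by rewrite -mulrA EFinM; apply: lee_wpmul2l; [rewrite lee_fin|exact: discount_bound].
Qed.

End fixed_horizon.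

End value_functions.

Lemma error_bound_vanishes {R : realType} (T rho normC normH lbar e : R) :
  0 < T -> 0 <= rho -> 0 <= normC -> 0 <= normH -> 0 < lbar -> 0 < e ->
  \forall m \near \oo, (0 < m)%N /\
    (error_bound T rho normC normH lbar m < e%:E)%E.
Proof.
move=> T_gt0 rho_ge0 C0 H0 l0 e0; pose K2 := T * normC + 2 * normH.
have K2_ge0 : 0 <= K2 by rewrite addr_ge0 ?mulr_ge0 ?(ltW T_gt0).
have K21 : 0 < K2 + 1 by rewrite ltr_wpDl.
have d0 : 0 < (e / (K2 + 1)) ^+ 2 by rewrite exprn_gt0// divr_gt0.
have [N _ HN] := grid_mesh_lt (lbar * T) d0.
exists N.+2 => // -[//|[//|m]]; rewrite /= !ltnS => Nm; split=> //.
rewrite /error_bound /= lte_fin.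
have -> : m.+2%:R - 1 = m.+1%:R :> R by rewrite -natr1 addrK.
have {HN} := HN m Nm; set x := lbar * T / m.+1%:R => xd.
have xge0 : 0 <= x by rewrite divr_ge0// mulr_ge0// ltW.
have y1 : (lbar / (2 * rho + lbar)) `^ (m.+2%:R / 2) <= 1.
  have s0 : 0 < 2 * rho + lbar by rewrite ltr_wpDl// mulr_ge0.
  apply: (@le_trans _ _ (1 `^ (m.+2%:R / 2))); last by rewrite powR1.
  apply: ge0_ler_powR; rewrite ?nnegrE ?divr_ge0 ?(ltW s0) ?(ltW l0)//.
  by rewrite ler_pdivrMr// mul1r lerDr mulr_ge0.
have sx : x `^ 2^-1 < e / (K2 + 1).
  rewrite powR12_sqrt// -(@ger0_norm _ (e / (K2 + 1))); last first.
    by rewrite divr_ge0// ltW.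
  by rewrite -sqrtr_sqr ltr_sqrt.
apply: (@le_lt_trans _ _ (K2 * x `^ 2^-1)).
  by rewrite ler_piMr// mulr_ge0// powR_ge0.
apply: (@le_lt_trans _ _ (K2 * (e / (K2 + 1)))); first by rewrite ler_wpM2l// ltW.
by rewrite mulrCA gtr_pMr// ltr_pdivrMr// mul1r ltrDl.
Qed.

Theorem proposition3p1
  (R : realType) (n a p : nat) (n_gt0 : (0 < n)%N) (a_gt0 : (0 < a)%N)
  (p_gt0 : (0 < p)%N)
  (T rho : R) (T_gt0 : 0 < T) (rho_ge0 : 0 <= rho)
  (c : 'I_n -> R) (mu : 'I_a -> 'I_n -> R)
  (Q : 'M[R]_n)
  (lambda : 'I_n -> R) (lambda_gt0 : forall i, 0 < lambda i)
  (nu : 'I_n -> probability (borelRV R p) R)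
  (nu0 : forall i, nu i [set (0 : 'rV[R]_p)] = 0%E)
  (nusum : {measure set (borelRV R p) -> \bar R})
  (nusumE : forall B, measurable B -> nusum B = (\sum_i nu i B)%E)
  (f : 'I_n -> borelRV R p -> R) (f_density : jump_density nu nusum f)
  (d : measure_display) (Omega : measurableType d)
  (Pr : 'rV[R]_n -> probability Omega R)
  (M : R -> Omega -> 'I_n) (Xi : 'I_n -> R -> Omega -> 'rV[R]_p)
  (model : forall pi, simplex n pi ->
     hidden_markov_model (Pr pi) Q lambda nu pi M Xi)
  (x0 : 'rV[R]_p) (X : R -> Omega -> 'rV[R]_p)
  (XE : X = observation x0 M Xi)
  (Pi : 'rV[R]_n -> R -> Omega -> 'rV[R]_n)
  (Pi_cond : forall pi, simplex n pi ->
     conditional_probability (Pr pi) (observation_filtration X) M (Pi pi))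
  (Pi_cadlag : forall pi, simplex n pi ->
     filter_dynamics (flow Pr lambda M) lambda f X pi (Pi pi)) :
  let C := linear_reward c in
  let H := terminal_reward mu in
  let V s pi := value rho C H (Pr pi) X (Pi pi) s in
  let Vm m s pi := value_jumps rho C H (Pr pi) X (Pi pi) m s in
  [/\ (forall s pi, 0 <= s <= T -> simplex n pi ->
         V s pi \is a fin_num /\
         forall m, (0 < m)%N -> Vm m s pi \is a fin_num),
      {uniform `[0, T] `*` simplex n,
         (fun (m : nat) (z : R * 'rV[R]_n) => fine (Vm m z.1 z.2)) @ \oo -->
         (fun z : R * 'rV[R]_n => fine (V z.1 z.2))} &
      forall s pi m, 0 <= s <= T -> simplex n pi -> (0 < m)%N ->
        (Vm m s pi <= V s pi)%E /\
        (V s pi <= Vm m s pi +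
          error_bound T rho (simplex_norm C) (simplex_norm H)
                      (max_rate lambda) m)%E].
Proof.
subst X => C H V Vm.
have fin s pi0 : 0 <= s <= T -> simplex n pi0 ->
    V s pi0 \is a fin_num /\ forall m, (0 < m)%N -> Vm m s pi0 \is a fin_num.
  move=> sT spi; split=> [|m _].
    exact: (value_fin_num c mu a_gt0 rho_ge0 lambda_gt0 (model _ spi)
      (Pi_cadlag _ spi) (Pi_cond _ spi) sT).
  exact: (value_jumps_fin_num c mu a_gt0 rho_ge0 lambda_gt0 (model _ spi)
      (Pi_cadlag _ spi) (Pi_cond _ spi) sT).
have bnd s pi0 m : 0 <= s <= T -> simplex n pi0 -> (0 < m)%N ->
    (Vm m s pi0 <= V s pi0)%E /\
    (V s pi0 <= Vm m s pi0 + error_bound T rho (simplex_norm C) (simplex_norm H)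
       (max_rate lambda) m)%E.
  move=> sT spi m0; split.
    exact: (value_jumps_le x0 c mu rho (model _ spi)).
  exact: (value_le_value_jumps c mu n_gt0 a_gt0 rho_ge0 T_gt0 lambda_gt0 (model _ spi)
    (Pi_cadlag _ spi) (Pi_cond _ spi) sT m0).
split=> //.
have C0 : 0 <= simplex_norm C by exact: linear_reward_norm_ge0.
have H0 : 0 <= simplex_norm H by exact: terminal_reward_norm_ge0.
have l0 := max_rate_gt0 n_gt0 lambda_gt0.
move=> U /uniform_nbhs[E [entE EU]].
move: entE; rewrite -entourage_ballE => -[e /= e0 eE].
have := error_bound_vanishes T_gt0 rho_ge0 C0 H0 l0 e0.
apply: filterS => m [m0 me]; apply: EU => -[s pi0] [/= sT spi].
rewrite in_itv/= in sT; apply: eE; rewrite /ball/=.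
have [Vfin Vmfin] := fin s pi0 sT spi; have {}Vmfin := Vmfin m m0.
have [lo hi] := bnd s pi0 m sT spi m0.
have {}hi : (V s pi0 < Vm m s pi0 + e%:E)%E.
  by rewrite (le_lt_trans hi)// lteD2lE.
move: lo hi; rewrite -(fineK Vfin) -(fineK Vmfin) -EFinD lee_fin lte_fin => lo hi.
by rewrite ger0_norm ?subr_ge0// ltrBlDl.
Qed.
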